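(* Let $(\gamma,\beta)\in(0,1)^2$ be such that $2\gamma+\beta<1$, and let $R>0$. There exists a constant $c(\gamma,\beta,R)>0$, depending only on $\gamma,\beta,R$, such that for every $\alpha>0$, every $s>0$ and every integer $n\ge2$, $$\rho_n^*\left(\mathcal B_{s,2,\infty}(R),\alpha,\gamma,\beta,\mathbf 1_{[0,1]}\right)\ \ge\ c(\gamma,\beta,R)\left[\left[(n z_\alpha^2)^{-2s/(4s+3)}\wedge(\log n)^{-1/2}\right]\vee n^{-2s/(4s+1)}\right],$$ where $z_\alpha=e^{2\alpha}-e^{-2\alpha}$ and $\rho_n^*$ is the $\alpha$-private minimax separation rate for non-interactive channels over the class $\mathcal B_{s,2,\infty}(R)$ with null density $f_0=\mathbf 1_{[0,1]}$.
   Context: Notation: $a\wedge b=\min(a,b)$, $a\vee b=\max(a,b)$; $\|\cdot\|_2$ is the norm of $\mathbb L_2([0,1])$ (Lebesgue measure). Non-interactive local differential privacy. $X_1,\dots,X_n$ are i.i.d. with values in $[0,1]$ and density $f$. A non-interactive $\alpha$-private channel $Q$ is given by Markov kernels (conditional distributions) $Q_1,\dots,Q_n$, where $Q_i(\cdot\mid x)$, $x\in[0,1]$, is a probability measure on a measurable space $(\tilde\Omega_i,\mathcal Z_i)$, satisfying for all $1\le i\le n$ $$\sup_{S\in\mathcal Z_i,\ (x,x')\in[0,1]^2}\frac{Q_i(Z_i\in S\mid X_i=x)}{Q_i(Z_i\in S\mid X_i=x')}\le e^{\alpha}.$$ $\mathcal Q_\alpha$ is the set of such channels. For a density $f$, $\mathbb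 P_{Q^n_f}$ is the law of the observed private views $(Z_1,\dots,Z_n)$: $\mathbb P_{Q^n_f}((Z_1,\dots,Z_n)\in\prod_i S_i)=\prod_{i=1}^n\int Q_i(Z_i\in S_i\mid X_i=x)f(x)\,dx$. Tests and rates. For a fixed density $f_0$ and $Q\in\mathcal Q_\alpha$, a $\gamma$-level test $\Delta_{\gamma,Q}$ is a $\{0,1\}$-valued measurable function of $(Z_1,\dots,Z_n)$ with $\mathbb P_{Q^n_{f_0}}(\Delta_{\gamma,Q}(Z_1,\dots,Z_n)=1)\le\gamma$. For a class $\mathcal C\subset\mathbb L_2([0,1])$ (the supremum below being over the probability densities $f$ in $\mathcal C$), $$\rho_n(\Delta_{\gamma,Q},\mathcal C,\beta,f_0)=\inf\Big\{\rho>0:\ \sup_{f\in\mathcal C,\ \|f-f_0\|_2>\rho}\mathbb P_{Q^n_f}(\Delta_{\gamma,Q}(Z_1,\dots,Z_n)=0)\le\beta\Big\},$$ $$\rho_n^*(\mathcal C,\alpha,\gamma,\beta,f_0)=\inf_{Q\in\mathcal Q_\alpha}\inf_{\Delta_{\gamma,Q}}\rho_n(\Delta_{\gamma,Q},\mathcal C,\beta,f_0),$$ where the inner infimum is over all $\gamma$-level tests based on the private views. Besov class (Haar basis). Let $\psi=\mathbf 1_{[0,1/2)}-\mathbf 1_{[1/2,1)}$, $\Lambda(j)=\{0,1,\dots,2^j-1\}$ and $\beta_{j,k}(g)=\int_0^1 2^{j/2}g(x)\psi(2^jx-k)\,dx$ for $j\ge0$, $k\in\Lambda(j)$. Put $$\widetilde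 B_{s,2,\infty}(R)=\Big\{g\in\mathbb L_2([0,1]):\ \forall j\ge0,\ \sum_{k\in\Lambda(j)}\beta_{j,k}^2(g)\le R^2 2^{-2js}\Big\},\qquad \mathcal B_{s,2,\infty}(R)=\{f\in\mathbb L_2([0,1]):\ f-f_0\in\widetilde B_{s,2,\infty}(R)\}.$$ *)

(* Defs.v *)
From HB Require Import structures.
From mathcomp Require Import all_boot all_order all_algebra.
From mathcomp Require Import all_classical all_reals all_analysis.
From mathcomp Require Import measurable_realfun.

Set Implicit Arguments.
Unset Strict Implicit.
Unset Printing Implicit Defensive.
Import Order.TTheory GRing.Theory Num.Theory.
Import numFieldNormedType.Exports.

Local Open Scope classical_set_scope.
Local Open Scope ring_scope.

(* Functions and kernels on [0,1] are represented by functions and kernels on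
   R; every notion below uses only their values on [0,1]. *)

Notation I01 R := (`[0, 1]%classic : set (measurableTypeR R)).

Record density (R : realType) := Density {
  density_fun :> R -> R;
  density_measurable : measurable_fun (I01 R) density_fun;
  density_ge0 : forall x, I01 R x -> 0 <= density_fun x;
  density_mass :
    (\int[lebesgue_measure]_(x in I01 R) (density_fun x)%:E = 1)%E }.

Section uniform_density.
Variable R : realType.

Let uniform_measurable : measurable_fun (I01 R) (\1_(I01 R) : R -> R).
Proof. exact: measurable_indic. Qed.

Let uniform_ge0 (x : R) : I01 R x -> 0 <= (\1_(I01 R) x : R).
Proof. by []. Qed.

Let uniform_mass :
  (\int[lebesgue_measure]_(x in I01 R) (\1_(I01 R) x : R)%:E = 1)%E.
Proof.
by rewrite integral_indic// setIid/= lebesgue_measure_itv/= lte_fin ltr01 oppr0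
  adde0.
Qed.

Definition uniform_density : density R :=
  Density uniform_measurable uniform_ge0 uniform_mass.

End uniform_density.

Section besov.
Variable R : realType.
Implicit Types f g : R -> R.

Definition L2norm g : \bar R :=
  'N[lebesgue_measure]_2%:E[EFin \o (g \_ (I01 R))].

Definition L2 : set (R -> R) :=
  [set g | (g \_ (I01 R)) \in Lfun lebesgue_measure 2%:E].

Definition haar (x : R) : R :=
  \1_(`[0, 2^-1[%classic : set R) x - \1_(`[2^-1, 1[%classic : set R) x.

Definition haar_coef (j k : nat) g : R :=
  \int[lebesgue_measure]_(x in I01 R)
    (2 `^ (j%:R / 2) * g x * haar (2 ^+ j * x - k%:R)).

Definition besov_ball (s M : R) : set (R -> R) :=
  [set g | L2 g /\ forall j : nat,
    \sum_(k < (2 ^ j)%N) haar_coef j k g ^+ 2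
      <= M ^+ 2 * 2 `^ (- (2 * j%:R * s))].

Definition besov (f0 : R -> R) (s M : R) : set (R -> R) :=
  [set f | L2 f /\ besov_ball s M (f \- f0)].

End besov.

Record mspace := MSpace {
  mspace_display : measure_display;
  mspace_sort :> measurableType mspace_display }.

(* Z_1 * (Z_2 * ( ... * (Z_n * unit))), with its product sigma-algebra *)
Fixpoint views n : ('I_n -> mspace) -> mspace :=
  match n with
  | 0%N => fun=> MSpace unit
  | _.+1 => fun Z => MSpace (Z ord0 * views (fun i => Z (lift ord0 i)))%type
  end.

Fixpoint box n :
    forall Z : 'I_n -> mspace, (forall i, set (Z i)) -> set (views Z) :=
  match n with
  | 0%N => fun _ _ => setT
  | _.+1 => fun Z S => S ord0 `*` box (fun i => S (lift ord0 i))
  end.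

Fixpoint prod_prob (R : realType) n : forall Z : 'I_n -> mspace,
    (forall i, probability (Z i) R) -> probability (views Z) R :=
  match n with
  | 0%N => fun _ _ => dirac (tt : unit)
  | _.+1 => fun Z P =>
      (P ord0 \x prod_prob (fun i => P (lift ord0 i)))%E
  end.

Lemma measurable_box n (Z : 'I_n -> mspace) (S : forall i, set (Z i)) :
  (forall i, measurable (S i)) -> measurable (box S).
Proof.
elim: n Z S => [|n IH] Z S mS /=; first exact: measurableT.
by apply: measurableX => //; exact: IH.
Qed.

Lemma prod_prob_box (R : realType) n (Z : 'I_n -> mspace)
    (P : forall i, probability (Z i) R) (S : forall i, set (Z i)) :
  (forall i, measurable (S i)) ->
  prod_prob P (box S) = (\big[*%E/1%E]_(i < n) P i (S i))%E.
Proof.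
elim: n Z P S => [|n IH] Z P S mS /=.
  by rewrite big_ord0 diracE in_setT.
rewrite big_ord_recl product_measure1E//; last exact: measurable_box.
by congr (_ * _)%E; exact: IH.
Qed.

Record channel (R : realType) (n : nat) := Channel {
  view_space : 'I_n -> mspace;
  privatize : forall i, R.-pker (measurableTypeR R) ~> (view_space i) }.

(* The likelihood-ratio bound in product form, so that 0/0 is allowed and
   p/0 with p > 0 is not. *)
Definition private (R : realType) n (alpha : R) (Q : channel R n) : Prop :=
  forall (i : 'I_n) (S : set (view_space Q i)), measurable S ->
    forall x x' : R, I01 R x -> I01 R x' ->
      (privatize Q i x S <= (expR alpha)%:E * privatize Q i x' S)%E.

Section view_law.
Variables (R : realType) (n : nat) (Q : channel R n) (f : density R).

Definition view_prob (i : 'I_n) (S : set (view_space Q i)) : \bar R :=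
  (\int[lebesgue_measure]_(x in I01 R) (privatize Q i x S * (f x)%:E))%E.

Section instances.
Variable i : 'I_n.

Let mf : measurable_fun (I01 R) (fun x => (f x)%:E).
Proof. by apply/measurable_EFinP; exact: density_measurable. Qed.

Let mQf S : measurable S ->
  measurable_fun (I01 R) (fun x => privatize Q i x S * (f x)%:E)%E.
Proof.
move=> mS; apply: emeasurable_funM => //.
by apply: measurable_funTS; exact: measurable_kernel.
Qed.

Let Qf_ge0 S x : I01 R x -> (0 <= privatize Q i x S * (f x)%:E)%E.
Proof. by move=> x01; rewrite mule_ge0// lee_fin; exact: density_ge0. Qed.

Let view_prob0 : view_prob (set0 : set (view_space Q i)) = 0%E.
Proof. by apply: integral0_eq => x _; rewrite measure0 mul0e. Qed.

Let view_prob_ge0 (S : set (view_space Q i)) : (0 <= view_prob S)%E.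
Proof. exact: integral_ge0 (Qf_ge0 S). Qed.

Let view_prob_sigma_additive : semi_sigma_additive (@view_prob i).
Proof.
move=> F mF tF mUF; rewrite /view_prob.
rewrite (eq_integral (fun x => \sum_(k <oo)
    (privatize Q i x (F k) * (f x)%:E)%E)%E); last first.
  move=> x _; rewrite measure_semi_bigcup// muleC -nneseriesZl//.
  by apply: eq_eseriesr => k _; rewrite muleC.
rewrite integral_nneseries//; last 2 first.
- by move=> k; exact: mQf.
- by move=> k x x01; exact: Qf_ge0.
by apply: is_cvg_nneseries => k _ _; exact: view_prob_ge0.
Qed.

HB.instance Definition _ := isMeasure.Build _ _ _ (@view_prob i)
  view_prob0 view_prob_ge0 view_prob_sigma_additive.

Let view_prob_setT : @view_prob i setT = 1%E.
Proof.
rewrite /view_prob -[RHS](density_mass f); apply: eq_integral => x _.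
by rewrite prob_kernel mul1e.
Qed.

HB.instance Definition _ := Measure_isProbability.Build _ _ _ (@view_prob i)
  view_prob_setT.

End instances.

Definition view_law : probability (views (view_space Q)) R :=
  prod_prob (fun i => @view_prob i : probability (view_space Q i) R).

Lemma view_law_box (S : forall i, set (view_space Q i)) :
  (forall i, measurable (S i)) ->
  view_law (box S) = \big[*%E/1%E]_(i < n) view_prob (S i).
Proof. exact: prod_prob_box. Qed.

End view_law.

Section rates.
Variables (R : realType) (n : nat).

Definition level_test (gamma : R) (Q : channel R n) (f0 : density R) :
    set (views (view_space Q) -> bool) :=
  [set Delta | measurable_fun setT Delta /\
    (view_law Q f0 [set z | Delta z = true] <= gamma%:E)%E].

Arguments level_test : clear implicits.

Definition rho_test (Q : channel R n) (Delta : views (view_space Q) -> bool)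
    (C : set (R -> R)) (beta : R) (f0 : density R) : \bar R :=
  ereal_inf [set rho%:E | rho in [set rho : R | 0 < rho /\
    (ereal_sup [set view_law Q f [set z | Delta z = false] | f in
       [set f : density R | C f /\ rho%:E < L2norm (f \- f0)%R]]
     <= beta%:E)%E]].

Definition rho_star (C : set (R -> R)) (alpha gamma beta : R)
    (f0 : density R) : \bar R :=
  ereal_inf [set rho : \bar R | exists2 Q : channel R n, private alpha Q &
    rho = ereal_inf
      [set rho_test Delta C beta f0 | Delta in level_test gamma Q f0]].

End rates.

(* Main.v *)
Require Import Defs.
From mathcomp Require Import all_boot all_order all_algebra.
From mathcomp Require Import all_classical all_reals all_analysis.
From mathcomp Require Import measurable_realfun.
From mathcomp Require Import ring lra zify.
From mathcomp Require complex.

Set Implicit Arguments.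
Unset Strict Implicit.
Unset Printing Implicit Defensive.
Import Order.TTheory GRing.Theory Num.Theory.
Import numFieldNormedType.Exports.
Local Open Scope classical_set_scope.
Local Open Scope ring_scope.

(** Why the bound holds.  Given a private channel and a level-gamma test, it
    suffices to exhibit one density in the Besov class, far enough from the
    uniform one, that the test misses with probability above beta
    ([rho_star_ge]).  The candidates are

      f_nu = 1 + sum_(k < N) c_k psi_(J,k),   N = 2^J,   c = delta (nu W),

    with nu a vector of m signs and W an m x N matrix with orthonormal rows.
    Only the resolution J is perturbed and |c|^2 = delta^2 m for every nu, so
    both the Besov condition and the distance to the uniform density are read
    off that one number.  The missing candidate is found by averaging over nu:
    if the mixture of the laws of the views under the f_nu is close in
    chi-square to the law under the uniform density, the test cannot reject
    most of them ([chi_square_event], [mixture_error]).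

    Seen through the i-th channel, psi_(J,k) becomes a score phi_(i,k), the
    conditional expectation of psi_(J,k)(X_i) given Z_i under the null, and
    the likelihood ratio of f_nu is the product over i of
    1 + sum_k c_k phi_(i,k) ([scores_exist], [prod_prob_likelihood]).  Hence
    the second moment of the mixture is an average over pairs (nu, nu') of
    prod_i (1 + c A_i c'^T) <= exp (delta^2 nu W A W^T nu'^T), where A_i is the
    Gram matrix of the scores and A the sum of the A_i.  This is the Laplace
    transform of a decoupled Rademacher chaos, at most
    exp (2 delta^4 kappa^2 m) as soon as the quadratic form of W A W^T is at
    most kappa ([sum_expR_chaos], [prior_error]).

    There are two ways of bounding kappa.  Conditional expectations are
    contractions, so A <= n; with W the identity this gives the rate
    n^(-2s/(4s+1)) ([full_prior_alternative], [nonprivate_rate]).  Privacy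
    bounds the oscillation of the channel densities, so each diagonal entry of
    A is at most n z^2 / (16 N).  The trace is then small, and at least half
    of the eigenvectors of A have an eigenvalue at most twice this bound;
    taking these as the rows of W ([low_energy_frame]) gives the rate
    (n z^2)^(-2s/(4s+3)) ([low_energy_alternative], [private_rate]).

    The logarithm is the price of positivity.  For the identity, |c_k| = delta
    and f_nu >= 0 is automatic.  For a general W each c_k is a Rademacher sum,
    and f_nu >= 0 only outside an event controlled by a union bound over the N
    coefficients ([signs_tail]); the mixture is restricted to the good signs,
    which costs a constant factor in its second moment.  When the private rate
    exceeds the other one, N <= n^2, so log N is of order log n; otherwise the
    other rate suffices.

    The constant does not depend on s because N is the ideal resolution
    rounded down to a power of 2: the smoothness constraint N^(-2s) only
    improves under this rounding, and the chi-square bound loses a power of 2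
    that does not involve s. *)

(** * Rademacher sums and decoupled chaos *)

Section rademacher.
Variable R : realType.

(** The bound is clear for |x| <= 1/2 from exp y <= 1/(1-y), and it
    propagates from x/2 to x because cosh (2y) = 2 (cosh y)^2 - 1 <= (cosh y)^4. *)
Lemma cosh_le_expR (x : R) : expR x + expR (- x) <= 2 * expR (2 * x ^+ 2).
Proof.
have small (y : R) : `|y| <= 2^-1 ->
    expR y + expR (- y) <= 2 * expR (2 * y ^+ 2).
  rewrite ler_norml => /andP[y1 y2].
  have h1 : expR y <= (1 - y)^-1.
    rewrite -[leLHS]invrK lef_pV2 ?posrE ?invr_gt0 ?expR_gt0//; last lra.
    by rewrite -expRN; exact: expR_ge1Dx.
  have h2 : expR (- y) <= (1 + y)^-1.
    rewrite expRN lef_pV2 ?posrE ?expR_gt0//; last lra.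
    exact: expR_ge1Dx.
  apply: (le_trans (lerD h1 h2)).
  have -> : (1 - y)^-1 + (1 + y)^-1 = 2 * (1 - y ^+ 2)^-1.
    by field; do ![apply/andP; split]; apply/eqP; nra.
  rewrite ler_pM2l//.
  have := expR_ge1Dx (2 * y ^+ 2); apply: le_trans.
  have y4 : y ^+ 2 <= 4^-1 by nra.
  rewrite -[leLHS]div1r ler_pdivrMr; last lra.
  by have := sqr_ge0 y; nra.
have [k hk] : exists k : nat, `|x| <= 2 ^+ k / 2.
  exists (Num.truncn (2 * `|x|)).+1.
  rewrite ler_pdivlMr// mulrC.
  have := truncnS_gt (2 * `|x|); move=> /ltW/le_trans; apply.
  by rewrite -natrX ler_nat ltnW// ltn_expl.
elim: k x hk => [|k IH] x hk.
  by apply: small; rewrite expr0 mul1r in hk.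
have {}IH : expR (x / 2) + expR (- (x / 2)) <= 2 * expR (2 * (x / 2) ^+ 2).
  apply: IH; rewrite normrM [X in _ * X]ger0_norm//.
  by rewrite ler_pM2r// (le_trans hk)// exprS mulrAC divff// mul1r.
have e1 : expR x = expR (x / 2) ^+ 2.
  by rewrite -expRM_natl; congr expR; field.
have e2 : expR (- x) = expR (- (x / 2)) ^+ 2.
  by rewrite -expRM_natl; congr expR; field.
have e3 : expR (2 * x ^+ 2) = (expR (2 * (x / 2) ^+ 2)) ^+ 4.
  by rewrite -expRM_natl; congr expR; field.
have e4 : expR (x / 2) * expR (- (x / 2)) = 1 by rewrite -expRD subrr expR0.
rewrite e1 e2 e3.
set u := expR (x / 2) in IH e4 *; set v := expR (- (x / 2)) in IH e4 *.
set w := expR (2 * (x / 2) ^+ 2) in IH *.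
have u0 : 0 < u := expR_gt0 _.
have v0 : 0 < v := expR_gt0 _.
have w0 : 0 < w := expR_gt0 _.
have h : (u + v) ^+ 2 <= 4 * w ^+ 2 by nra.
have -> : u ^+ 2 + v ^+ 2 = (u + v) ^+ 2 - 2 by rewrite sqrrD e4; ring.
have h1 : (u + v) ^+ 2 - 2 <= 4 * w ^+ 2 - 2 by lra.
apply: (le_trans h1).
have := sqr_ge0 (w ^+ 2 - 1).
rewrite -subr_ge0 => h2; rewrite -subr_ge0.
have -> : 2 * w ^+ 4 - (4 * w ^+ 2 - 2) = 2 * ((w ^+ 2 - 1) ^+ 2) by ring.
by rewrite mulr_ge0// sqr_ge0.
Qed.

Definition signs m (nu : {ffun 'I_m -> bool}) : 'rV[R]_m :=
  \row_l (-1) ^+ nu l.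

(** The signs are independent, so the Laplace transform of a Rademacher sum
    factors into hyperbolic cosines. *)
Lemma sum_expR_signs m (a : 'cV[R]_m) :
  \sum_(nu : {ffun 'I_m -> bool}) expR ((signs nu *m a) 0 0)
    <= 2 ^+ m * expR (2 * \sum_l a l 0 ^+ 2).
Proof.
rewrite (eq_bigr (fun nu : {ffun 'I_m -> bool} =>
    \prod_l expR ((-1) ^+ nu l * a l 0))); last first.
  by move=> nu _; rewrite mxE expR_sum; apply: eq_bigr => l _; rewrite mxE.
rewrite -(bigA_distr_bigA (fun l (b : bool) => expR ((-1) ^+ b * a l 0))) /=.
rewrite mulr_sumr expR_sum.
have -> : (2 : R) ^+ m = \prod_(l < m) 2 by rewrite prodr_const card_ord.
rewrite -big_split /=; apply: ler_prod => l _; rewrite big_bool /=.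
rewrite addr_ge0 ?expR_ge0//= addrC expr0 expr1 mul1r mulN1r.
exact: cosh_le_expR.
Qed.

End rademacher.

Section chaos.
Variables (R : realType) (m : nat).
Implicit Types (x y a : 'cV[R]_m) (C : 'M[R]_m).

Definition sqnorm x : R := \sum_l x l 0 ^+ 2.
Definition qform C x : R := (x^T *m C *m x) 0 0.

Lemma sqnormE x : sqnorm x = (x^T *m x) 0 0.
Proof. by rewrite mxE; apply: eq_bigr => l _; rewrite mxE expr2. Qed.

Lemma sqnorm_signs (nu : {ffun 'I_m -> bool}) :
  sqnorm (signs R nu)^T = m%:R.
Proof.
rewrite /sqnorm (eq_bigr (fun=> 1)) ?sumr_const ?card_ord// => l _.
by rewrite !mxE sqrr_sign.
Qed.

(** For 0 <= C <= kappa one has C^2 <= kappa C: evaluate the nonnegative form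
    of C at kappa x - C x. *)
Lemma sqnorm_mulmx_le C (kappa : R) : 0 < kappa -> C^T = C ->
  (forall x, 0 <= qform C x) -> (forall x, qform C x <= kappa * sqnorm x) ->
  forall x, sqnorm (C *m x) <= kappa ^+ 2 * sqnorm x.
Proof.
move=> k0 symC C0 Ck x; set y := C *m x.
have := C0 (kappa *: x - y).
have -> : qform C (kappa *: x - y) =
    kappa ^+ 2 * qform C x - 2 * kappa * sqnorm y + qform C y.
  have e1 : x^T *m C = y^T by rewrite trmx_mul symC.
  have e2 : (kappa *: x - y)^T = kappa *: x^T - y^T.
    by apply/matrixP => i j; rewrite !mxE.
  rewrite /qform e2 !mulmxBl !mulmxBr.
  rewrite -!(scalemxAl, scalemxAr) sqnormE.
  have -> : y^T *m C *m x = y^T *m y by rewrite -mulmxA.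
  have -> : x^T *m C *m y = y^T *m y by rewrite e1.
  move: (x^T *m C *m x) (y^T *m y) (y^T *m C *m y) => p q r.
  by rewrite !mxE; ring.
by have := Ck x; have := Ck y; move: (sqnorm y) (sqnorm x) => Y X; nra.
Qed.

(** Conditionally on the second sign vector the chaos is a Rademacher sum
    with coefficients t C nu', whose norm is at most t kappa sqrt m. *)
Lemma sum_expR_chaos C (kappa t : R) :
  (forall x, sqnorm (C *m x) <= kappa ^+ 2 * sqnorm x) ->
  \sum_(nu : {ffun 'I_m -> bool}) \sum_(nu' : {ffun 'I_m -> bool})
    expR (t * (signs R nu *m C *m (signs R nu')^T) 0 0)
  <= (2 ^+ m) ^+ 2 * expR (2 * t ^+ 2 * kappa ^+ 2 * m%:R).
Proof.
move=> hC; rewrite exchange_big /=.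
have h (nu' : {ffun 'I_m -> bool}) : true ->
    \sum_(nu : {ffun 'I_m -> bool})
      expR (t * (signs R nu *m C *m (signs R nu')^T) 0 0)
    <= 2 ^+ m * expR (2 * t ^+ 2 * kappa ^+ 2 * m%:R).
  move=> _.
  rewrite (eq_bigr (fun nu : {ffun 'I_m -> bool} =>
      expR ((signs R nu *m (t *: (C *m (signs R nu')^T))) 0 0))); last first.
    by move=> nu _; rewrite -scalemxAr mulmxA [in RHS]mxE.
  apply: (le_trans (sum_expR_signs _)).
  rewrite ler_pM2l ?exprn_gt0// ler_expR -(mulrA 2) -(mulrA 2).
  rewrite ler_pM2l// -[leRHS]mulrA.
  under eq_bigr do rewrite mxE exprMn.
  rewrite -mulr_sumr ler_wpM2l ?sqr_ge0//.
  by rewrite (le_trans (hC _))// sqnorm_signs.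
apply: le_trans (_ : _ <= \sum_(nu' : {ffun 'I_m -> bool}) _) _.
  by apply: ler_sum; exact: h.
rewrite sumr_const card_ffun card_bool card_ord.
by rewrite -[_ *+ _]mulr_natl natrX mulrA expr2.
Qed.

(** Chernoff bound for both signs of a, with the exponent u/4 which is optimal
    for the constant 2 of [sum_expR_signs]. *)
Lemma signs_tail a (u : R) : 0 <= u -> sqnorm a <= 1 ->
  #|[pred nu : {ffun 'I_m -> bool} | u < `|(signs R nu *m a) 0 0|]|%:R
    <= 2 * 2 ^+ m * expR (- (u ^+ 2 / 8)).
Proof.
move=> u0 a1; set s := u / 4.
have key (b : 'cV[R]_m) : sqnorm b <= 1 ->
    \sum_(nu : {ffun 'I_m -> bool}) expR (s * ((signs R nu *m b) 0 0 - u))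
      <= 2 ^+ m * expR (- (u ^+ 2 / 8)).
  move=> b1.
  rewrite (eq_bigr (fun nu : {ffun 'I_m -> bool} =>
      expR ((signs R nu *m (s *: b)) 0 0) * expR (- (s * u)))); last first.
    move=> nu _; rewrite -expRD; congr expR.
    by rewrite -scalemxAr [in RHS]mxE mulrBr.
  rewrite -mulr_suml.
  apply: (le_trans (ler_wpM2r (expR_ge0 _) (sum_expR_signs _))).
  rewrite -mulrA ler_pM2l ?exprn_gt0// -expRD ler_expR.
  under eq_bigr do rewrite mxE exprMn.
  rewrite -mulr_sumr -/(sqnorm b).
  have -> : - (u ^+ 2 / 8) = 2 * (s ^+ 2 * 1) - s * u by rewrite /s; field.
  by rewrite lerD2r ler_pM2l// ler_wpM2l ?sqr_ge0.
have : \sum_(nu : {ffun 'I_m -> bool})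
    (expR (s * ((signs R nu *m a) 0 0 - u)) +
     expR (s * ((signs R nu *m (- a)) 0 0 - u)))
    <= 2 * 2 ^+ m * expR (- (u ^+ 2 / 8)).
  rewrite big_split /= -mulrA mulr2n mulrDl mul1r lerD// key//.
  by rewrite /sqnorm; under eq_bigr do rewrite mxE sqrrN.
apply: le_trans.
rewrite -sum1_card natr_sum big_mkcond /=; apply: ler_sum => nu _.
rewrite inE; case: ifPn => [|_]; last by rewrite addr_ge0 ?expR_ge0.
rewrite lter_normr => /orP[h|h].
  rewrite -[leLHS]addr0 lerD ?expR_ge0// -expR0 ler_expR mulr_ge0//.
    by rewrite divr_ge0.
  by rewrite subr_ge0 ltW.
rewrite -[leLHS]add0r lerD ?expR_ge0// -expR0 ler_expR mulr_ge0//.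
  by rewrite divr_ge0.
by rewrite mulmxN mxE subr_ge0 ltW.
Qed.

End chaos.

(** * Orthogonal frames on which a positive form of small trace is small *)

Section spectral.
Import complex.
Variable R : realType.

(** An eigenvalue exists over the complex numbers; it is real because the
    matrix is Hermitian, hence a root of the real characteristic polynomial, and
    a real eigenvector follows. *)
Lemma symmetric_eigenvector n (A : 'M[R]_n.+1) : A^T = A ->
  exists lambda (v : 'rV[R]_n.+1), v != 0 /\ v *m A = lambda *: v.
Proof.
move=> symA; pose C : numClosedFieldType := complex.complex R.
pose toC : {rmorphism R -> C} := complex.real_complex_def (Phant R).
pose AC := map_mx toC A.
have [a ea] : exists a, eigenvalue AC a by exact: spectral.eigenvalue_closed.
have [v vA v0] := eigenvalueP ea.
have real_a : a \is Num.real.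
  pose vb := (map_mx Num.conj v)^T.
  have s0 : (v *m vb) 0 0 != 0.
    rewrite mxE psumr_neq0.
      move/rV0Pn : v0 => [i vi]; apply/hasP; exists i.
        by rewrite mem_index_enum.
      by rewrite /= !mxE lt_neqAle mul_conjC_ge0 eq_sym mulf_neq0// conjC_eq0.
    by move=> i _; rewrite !mxE mul_conjC_ge0.
  have h1 : (v *m AC *m vb) 0 0 = a * (v *m vb) 0 0.
    by rewrite vA -scalemxAl mxE.
  have h2 : ((v *m vb) 0 0)^* = (v *m vb) 0 0.
    rewrite !mxE rmorph_sum; apply: eq_bigr => i _.
    by rewrite !mxE rmorphM/= conjCK mulrC.
  have h3 : ((v *m AC *m vb) 0 0)^* = (v *m AC *m vb) 0 0.
    have symAC : AC^T = AC by rewrite /AC map_trmx symA.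
    have conjAC : map_mx Num.conj AC = AC.
      apply/matrixP => i j; rewrite !mxE; apply: conj_Creal.
      by apply/complex_realP; exists (A i j).
    have conjvb : map_mx Num.conj vb = v^T.
      by apply/matrixP => i j; rewrite !mxE conjCK.
    transitivity ((map_mx Num.conj (v *m AC *m vb)) 0 0); first by rewrite [RHS]mxE.
    rewrite !map_mxM conjAC conjvb.
    transitivity ((map_mx Num.conj v *m AC *m v^T)^T 0 0); first by rewrite [RHS]mxE.
    by rewrite !trmx_mul trmxK symAC mulmxA.
  apply/CrealP; apply: (mulIf s0).
  by rewrite -h1 -h3 h1 rmorphM/= h2.
have [r ar] : exists r, a = toC r.
  have /complex_realP[k ->] := real_a.
  by exists k.
have : eigenvalue A r.
  rewrite eigenvalue_root_char -(fmorph_root toC).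
  by rewrite map_char_poly /= -ar -eigenvalue_root_char.
by move=> /eigenvalueP[w wA w0]; exists r, w.
Qed.

End spectral.

Section diagonalization.
Variable R : realType.

(** The Householder reflection that exchanges v and the first basis vector. *)
Lemma orthogonal_completion n (v : 'rV[R]_n.+1) : v *m v^T = 1%:M ->
  exists H : 'M[R]_n.+1, H *m H^T = 1%:M /\ row 0 H = v.
Proof.
move=> v1; pose e : 'rV[R]_n.+1 := delta_mx 0 0.
have [->|ve] := eqVneq v e.
  exists 1%:M; split; first by rewrite trmx1 mulmx1.
  by rewrite row1.
have [w wE] : exists w, w = v - e by exists (v - e).
have [q qdef] : exists q, q = (w *m w^T) 0 0 by exists ((w *m w^T) 0 0).
have ee : e *m e^T = 1%:M.
  apply/matrixP => i j; rewrite !ord1 !mxE (bigD1 ord0)//= big1.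
    by rewrite !mxE eqxx mulr1 addr0.
  by move=> k k0; rewrite !mxE (negPf k0) andbF mul0r.
have ev : v *m e^T = e *m v^T.
  rewrite -[LHS]trmxK trmx_mul trmxK.
  by apply/matrixP => i j; rewrite !ord1 mxE.
have qE : q = 2 * (1 - (e *m v^T) 0 0).
  have wT : w^T = v^T - e^T by rewrite wE; apply/matrixP => i j; rewrite !mxE.
  rewrite qdef wT wE mulmxBl !mulmxBr v1 ee ev.
  by move: (e *m v^T) => p; rewrite !mxE eqxx mulr1n; ring.
have q0 : q != 0.
  rewrite qdef mxE psumr_neq0.
    have : w != 0 by rewrite wE subr_eq0.
    move=> /rV0Pn[i wi]; apply/hasP; exists i; first by rewrite mem_index_enum.
    by rewrite /= [w^T _ _]mxE -expr2 lt_neqAle sqr_ge0 eq_sym sqrf_eq0 wi.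
  by move=> i _; rewrite [w^T _ _]mxE -expr2 sqr_ge0.
have wwE : w *m w^T = q%:M by rewrite [LHS]mx11_scalar qdef.
pose H : 'M[R]_n.+1 := 1%:M - (2 / q) *: (w^T *m w).
have HT : H^T = H.
  by rewrite /H linearB/= linearZ/= trmx_mul trmxK trmx1.
exists H; split.
  rewrite HT {1}/H mulmxBl mul1mx -scalemxAl /H !mulmxBr mulmx1.
  rewrite -scalemxAr mulmxA -[w^T *m w *m w^T]mulmxA wwE.
  rewrite mul_mx_scalar -scalemxAl scalerBr opprB !scalerA.
  apply/matrixP => i j; rewrite !mxE.
  move: (\sum_ _ _) (i == j)%:R => p z.
  by field.
have w00 : w 0 0 = - (q / 2).
  rewrite qE wE !mxE (bigD1 ord0)//= big1 => [|k k0]; last first.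
    by rewrite !mxE (negPf k0) andbF mul0r.
  by rewrite !mxE eqxx mul1r addr0 mulr1n; field.
have -> : row 0 H = e - (2 / q) *: (w 0 0 *: w).
  apply/rowP => j; rewrite !mxE big_ord_recl big_ord0 addr0 !mxE.
  by rewrite eqxx [0 == j]eq_sym.
rewrite w00 scalerA (_ : 2 / q * - (q / 2) = -1); last by field.
by rewrite scaleN1r opprK wE addrC subrK.
Qed.

(** Conjugating by an orthogonal matrix whose first row is a unit eigenvector
    splits off a 1 x 1 block, and induction treats the other one. *)
Lemma symmetric_diagonalization n (A : 'M[R]_n) : A^T = A ->
  exists (U : 'M[R]_n) (d : 'rV[R]_n),
    U *m U^T = 1%:M /\ U *m A *m U^T = diag_mx d.
Proof.
elim: n A => [|n IH] A symA.
  exists 1%:M, 0; split; apply/matrixP => -[]//.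
have [lambda [v [v0 vA]]] := symmetric_eigenvector symA.
pose s := (v *m v^T) 0 0.
have s0 : 0 < s.
  rewrite /s mxE; move/rV0Pn : v0 => [i vi].
  rewrite (bigD1 i)//= ltr_pwDl//.
    by rewrite mxE -expr2 lt_neqAle sqr_ge0 eq_sym sqrf_eq0 vi.
  by apply: sumr_ge0 => j _; rewrite mxE -expr2 sqr_ge0.
pose u := (Num.sqrt s)^-1 *: v.
have u1 : u *m u^T = 1%:M.
  rewrite /u linearZ/= -scalemxAl -scalemxAr scalerA.
  rewrite [v *m v^T]mx11_scalar -/s -invfM -expr2 sqr_sqrtr ?ltW//.
  by rewrite scale_scalar_mx mulVf ?gt_eqF.
have uA : u *m A = lambda *: u.
  by rewrite /u -scalemxAl vA !scalerA mulrC.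
have [P [PP rP]] := orthogonal_completion u1.
pose B : 'M[R]_(1 + n)%N := P *m A *m P^T.
have symB : B^T = B by rewrite /B !trmx_mul trmxK symA mulmxA.
have rB : row 0 B = lambda *: delta_mx 0 0.
  rewrite /B !row_mul rP uA -scalemxAl -rP -row_mul PP row1.
  by [].
have urB : ursubmx B = 0.
  apply/matrixP => i j; rewrite !mxE.
  move/rowP : rB => /(_ (rshift 1 j)); rewrite !mxE/= !ord1.
  rewrite (_ : lshift n 0 = 0)//; last exact: val_inj.
  by move=> ->; rewrite mulr0.
have ulB : ulsubmx B = lambda%:M.
  apply/matrixP => i j; rewrite !ord1 !mxE.
  move/rowP : rB => /(_ (lshift n 0)); rewrite !mxE/= .
  rewrite (_ : lshift n 0 = 0)//; last exact: val_inj.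
  by move=> ->; rewrite ?eqxx/= ?mulr1 ?mulr1n.
have dlB : dlsubmx B = 0 by rewrite -[LHS]trmxK trmx_dlsub symB urB trmx0.
have symD : (drsubmx B)^T = drsubmx B by rewrite trmx_drsub symB.
have [U [d [UU UD]]] := IH _ symD.
pose V : 'M[R]_(1 + n)%N := block_mx 1%:M 0 0 U.
have VT : V^T = block_mx 1%:M 0 0 U^T by rewrite tr_block_mx !trmx0 trmx1.
have VV : V *m V^T = 1%:M.
  rewrite VT /V mulmx_block.
  by rewrite !(mulmx0, mul0mx, addr0, add0r, mulmx1) UU -scalar_mx_block.
have VBV : V *m B *m V^T = diag_mx (row_mx lambda%:M d).
  rewrite VT /V -[B]submxK urB ulB dlB !mulmx_block.
  rewrite !(mulmx0, mul0mx, addr0, add0r, mulmx1, mul1mx) UD.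
  rewrite diag_mx_row; congr block_mx.
  by apply/matrixP => i j; rewrite !ord1 !mxE.
exists (V *m P), (row_mx lambda%:M d); split.
  by rewrite trmx_mul mulmxA -[V *m P *m _]mulmxA PP mulmx1.
rewrite trmx_mul !mulmxA -VBV /B.
by rewrite !mulmxA.
Qed.

End diagonalization.

(** Markov inequality on the spectrum: the trace is at most N tau, so at most
    half of the eigenvalues exceed 2 tau; the rows of W are the eigenvectors of
    the others. *)
Lemma low_energy_frame (R : realType) N (A : 'M[R]_N) (tau : R) :
  0 < tau -> A^T = A -> (forall x, 0 <= qform A x) ->
  (forall k, A k k <= tau) ->
  exists m (W : 'M[R]_(m, N)), [/\ (m <= N <= 2 * m)%N, W *m W^T = 1%:M,
    forall k, \sum_l W l k ^+ 2 <= 1 &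
    forall x, qform (W *m A *m W^T) x <= 2 * tau * sqnorm x].
Proof.
move=> tau0 symA psdA At; have [U [d [UU UA]]] := symmetric_diagonalization symA.
have UU' : U^T *m U = 1%:M by exact: mulmx1C.
have dE l : d 0 l = qform A (row l U)^T.
  have /matrixP/(_ l l) := UA; rewrite [X in _ = X]mxE eqxx mulr1n => <-.
  rewrite /qform trmxK -row_mul mxE [RHS]mxE.
  by apply: eq_bigr => j _; rewrite !mxE.
have d0 l : 0 <= d 0 l by rewrite dE.
have sumd : \sum_l d 0 l <= N%:R * tau.
  rewrite -mxtrace_diag -UA mxtrace_mulC mulmxA UU' mul1mx.
  apply: (@le_trans _ _ (\sum_(i < N) tau)); first by apply: ler_sum.
  by rewrite sumr_const card_ord mulr_natl.
pose L := [pred l : 'I_N | d 0 l <= 2 * tau].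
pose f (l : 'I_#|L|) : 'I_N := enum_val l.
have injf : injective f by exact: enum_val_inj.
exists #|L|, (rowsub f U); split.
- have : (#|[predC L]|%:R * (2 * tau) <= N%:R * tau :> R).
    apply: le_trans sumd; rewrite mulr_natl -sumr_const.
    rewrite [leRHS](bigID (fun l => l \in L)) /= -[leLHS]add0r lerD ?sumr_ge0//.
    by apply: ler_sum => l; rewrite !inE -ltNge => /ltW.
  rewrite mulrA ler_pM2r// -natrM ler_nat.
  have c : (#|L| + #|[predC L]| = N)%N by rewrite cardC card_ord.
  by move: #|L| #|[predC L]| c => a b; lia.
- apply/matrixP => i j; rewrite trmx_mxsub -mxsub_mul.
  have /matrixP/(_ (f i) (f j)) := UU; rewrite !mxE => ->.
  by rewrite (inj_eq injf).
- move=> k; have /matrixP/(_ k k) := UU'; rewrite !mxE eqxx mulr1n.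
  move=> <-; rewrite (eq_bigr (fun l => U (f l) k ^+ 2)); last first.
    by move=> l _; rewrite mxE.
  rewrite [leRHS](eq_bigr (fun l => U l k ^+ 2)); last first.
    by move=> l _; rewrite mxE expr2.
  rewrite -(big_enum_val (fun l => U l k ^+ 2)) /=.
  rewrite [leRHS](bigID (fun l => l \in L)) /= -[leLHS]addr0 lerD ?sumr_ge0//.
  by move=> l _; exact: sqr_ge0.
- move=> x; rewrite trmx_mxsub mul_rowsub_mx -mxsub_mul UA.
  have -> : mxsub f f (diag_mx d) = diag_mx (colsub f d).
    by apply/matrixP => i j; rewrite !mxE (inj_eq injf).
  rewrite /qform mul_mx_diag mxE mulr_sumr; apply: ler_sum => l _.
  rewrite !mxE mulrAC -expr2 mulrC ler_wpM2r ?sqr_ge0//.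
  exact: (enum_valP l).
Qed.

(** * Bounded densities with respect to a common probability *)

Section densities.
Context d (T : measurableType d) (R : realType).

Lemma bounded_integrable (mu : {finite_measure set T -> \bar R})
    (f : T -> R) (K : R) :
  measurable_fun setT f -> (forall x, `|f x| <= K) ->
  mu.-integrable setT (EFin \o f).
Proof.
move=> mf fK.
apply: (@le_integrable _ _ _ mu setT measurableT _ (EFin \o cst K)).
- exact/measurable_EFinP.
- by move=> x _; rewrite /= lee_fin (le_trans (fK x))//= ler_norm.
- exact: finite_measure_integrable_cst.
Qed.

Section finite_linearity.
Variables (mu : {measure set T -> \bar R}) (D : set T).
Hypothesis mD : measurable D.

Lemma integrable_scale (a : R) (f : T -> R) :
  mu.-integrable D (EFin \o f) -> mu.-integrable D (EFin \o (fun x => a * f x)).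
Proof.
move=> If; have := integrableZl mD a If.
by apply: eq_integrable => // x _ /=; rewrite EFinM.
Qed.

Lemma integrable_fsum (I : finType) (f : I -> T -> R) :
  (forall i, mu.-integrable D (EFin \o f i)) ->
  mu.-integrable D (EFin \o (fun x => \sum_i f i x)).
Proof.
move=> If; have := integrable_sum mD (index_enum I) (P := xpredT) (fun i _ => If i).
by apply: eq_integrable => // x _ /=; rewrite sumEFin.
Qed.

Lemma Rintegral_fsum (I : finType) (f : I -> T -> R) :
  (forall i, mu.-integrable D (EFin \o f i)) ->
  \int[mu]_(x in D) \sum_i f i x = \sum_i \int[mu]_(x in D) f i x.
Proof.
move=> If; rewrite /Rintegral.
under eq_integral do rewrite -sumEFin.
rewrite integral_sum//.
rewrite (eq_bigr (fun i => (fine (\int[mu]_(x in D) (f i x)%:E)%E)%:E)).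
  by rewrite sumEFin.
by move=> i _; rewrite fineK//; exact: (integrable_fin_num _ (If i)).
Qed.

End finite_linearity.

Lemma measurable_lt_set (f g : T -> R) :
  measurable_fun setT f -> measurable_fun setT g ->
  measurable [set x | f x < g x].
Proof.
move=> mf mg; have := measurable_fun_ltr mf mg => /(_ measurableT [set true]).
rewrite setTI; apply; exact I.
Qed.

(** Integrate f - g over the set where it is positive. *)
Lemma integral_le_ae (mu : {finite_measure set T -> \bar R}) (f g : T -> R) :
  mu.-integrable setT (EFin \o f) -> mu.-integrable setT (EFin \o g) ->
  (forall S, measurable S ->
    (\int[mu]_(x in S) (f x)%:E <= \int[mu]_(x in S) (g x)%:E)%E) ->
  mu [set x | g x < f x] = 0%E.
Proof.
move=> If Ig fg; set D := [set x | _].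
have mf : measurable_fun setT f by apply/measurable_EFinP/(measurable_int mu).
have mg : measurable_fun setT g by apply/measurable_EFinP/(measurable_int mu).
have mD : measurable D by exact: measurable_lt_set.
have IfD : mu.-integrable D (EFin \o f) by exact: integrableS If.
have IgD : mu.-integrable D (EFin \o g) by exact: integrableS Ig.
have fin : (\int[mu]_(x in D) (g x)%:E)%E \is a fin_num by exact: integrable_fin_num.
have h : (\int[mu]_(x in D) `|((EFin \o f) \- (EFin \o g)) x|)%E = 0%E.
  transitivity (\int[mu]_(x in D) ((EFin \o f) x - (EFin \o g) x))%E.
    apply: eq_integral => x; rewrite inE => Dx /=.
    by rewrite ger0_norm// subr_ge0 ltW.
  rewrite integralB//; apply/eqP; rewrite eq_le sube_le0 fg//=.
  rewrite sube_ge0 ?fin//.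
  apply: (@le_integral _ _ _ mu _ mD (EFin \o g) (EFin \o f)) => //.
  by move=> x; rewrite inE /= lee_fin => /ltW.
have mfg : measurable_fun D ((EFin \o f) \- (EFin \o g))%E.
  by apply: emeasurable_funB; apply/measurable_EFinP; exact: measurable_funTS.
have /(ae_eq_integral_abs mu mD mfg) := h.
move=> nfg; apply: (measure_negligible mD); apply: negligibleS nfg.
move=> x Dx /= /(_ Dx) /eqP; rewrite eqe subr_eq0 => /eqP fgx.
by move: Dx; rewrite /D/= fgx ltxx.
Qed.

(** The densities given by the Radon-Nikodym theorem satisfy the stated bounds
    almost everywhere.  On the null set where one of them fails every density is
    reset to 1, a value compatible with all the bounds since each P i and P0 have
    total mass 1; the bounds then hold at every point. *)
Lemma common_density (I : finType) (P : I -> probability T R)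
    (P0 : probability T R) (a b K : R) :
  (forall i S, measurable S -> (a%:E * P0 S <= P i S)%E) ->
  (forall i S, measurable S -> (P i S <= b%:E * P0 S)%E) ->
  (forall S, measurable S -> (\sum_i P i S <= K%:E * P0 S)%E) ->
  exists p : I -> T -> R, [/\ forall i, measurable_fun setT (p i),
    forall i x, a <= p i x <= b, forall x, \sum_i p i x <= K &
    forall i S, measurable S -> P i S = (\int[P0]_(x in S) (p i x)%:E)%E].
Proof.
move=> Pa Pb PK.
have a1 (i : I) : a <= 1.
  by have := Pa i _ measurableT; rewrite !probability_setT mule1 lee_fin.
have b1 (i : I) : 1 <= b.
  by have := Pb i _ measurableT; rewrite !probability_setT mule1 lee_fin.
have cardK : \sum_(i : I) 1 <= K.
  have := PK _ measurableT; rewrite probability_setT mule1.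
  rewrite (eq_bigr (fun=> 1%:E)); last by move=> i _; rewrite probability_setT.
  by rewrite sumEFin lee_fin.
have RN i : exists g : T -> R, [/\ forall x, 0 <= g x,
    P0.-integrable setT (EFin \o g) &
    forall S, measurable S -> P i S = (\int[P0]_(x in S) (g x)%:E)%E].
  have dom : P i `<< P0.
    apply/null_content_dominatesP => S mS P0S; apply/eqP.
    by rewrite eq_le measure_ge0 andbT (le_trans (Pb i S mS))// P0S mule0.
  have [h [h0 hfin Ih hE]] := radon_nikodym_sigma_finite dom.
  have hh x : (fine (h x))%:E = h x by rewrite fineK.
  exists (fine \o h); split => [x||S mS].
  - exact: fine_ge0.
  - by apply: eq_integrable Ih => // x _ /=; rewrite hh.
  - by rewrite hE//; apply: eq_integral => x _ /=; rewrite hh.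
have [g /all_and3[g0 Ig gE]] := choice RN.
have mg i : measurable_fun setT (g i).
  by apply/measurable_EFinP/(measurable_int P0).
have cstE (r : R) S : measurable S ->
    (\int[P0]_(x in S) (cst r x)%:E)%E = (r%:E * P0 S)%E.
  by move=> mS; exact: (integral_cst P0 mS r%:E).
have Icst (r : R) : P0.-integrable setT (EFin \o cst r).
  exact: finite_measure_integrable_cst.
have nA i : P0 [set x | g i x < a] = 0%E.
  apply: (integral_le_ae (f := cst a)) => // S mS.
  by rewrite cstE// -gE// Pa.
have nB i : P0 [set x | b < g i x] = 0%E.
  apply: (integral_le_ae (g := cst b)) => // S mS.
  by rewrite cstE// -gE// Pb.
have Isum : P0.-integrable setT (EFin \o (fun x => \sum_i g i x)).
  have := integrable_sum measurableT (index_enum I) (P := xpredT) (fun i _ => Ig i).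
  apply: eq_integrable => // x _ /=; by rewrite sumEFin.
have nK : P0 [set x | K < \sum_i g i x] = 0%E.
  apply: (integral_le_ae (g := cst K)) => // S mS.
  rewrite cstE//; apply: le_trans (PK S mS).
  rewrite (eq_bigr _ (fun i _ => gE i S mS)) -ge0_integral_sum//.
  - rewrite le_eqVlt; apply/orP; left; apply/eqP.
    by apply: eq_integral => x _; rewrite sumEFin.
  - by move=> i; apply: measurable_funTS; apply/measurable_EFinP.
  - by move=> i x _; rewrite lee_fin.
pose bad : set T := \big[setU/set0]_i ([set x | g i x < a] `|` [set x | b < g i x])
  `|` [set x | K < \sum_i g i x].
have mA i : measurable [set x | g i x < a].
  exact: (measurable_lt_set (g := cst a)).
have mB i : measurable [set x | b < g i x].
  exact: (measurable_lt_set (f := cst b)).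
have mK : measurable [set x | K < \sum_i g i x].
  by apply: (measurable_lt_set (f := cst K)) => //; exact: measurable_sum.
have mbad : measurable bad.
  apply: measurableU => //.
  by apply: bigsetU_measurable => i _; exact: measurableU.
have bad0 : P0 bad = 0%E.
  apply: measure_negligible => //; apply: negligibleU.
    apply: (big_ind (fun A : set T => P0.-negligible A)); first exact: negligible_set0.
      by move=> A B hA hB; exact: (negligibleU hA hB).
    move=> i _; apply: negligibleU.
      by apply/(negligibleP P0 (mA i)); exact: nA.
    by apply/(negligibleP P0 (mB i)); exact: nB.
  exact/(negligibleP P0 mK).
have goodP x : ~ bad x -> (forall i, a <= g i x <= b) /\ \sum_i g i x <= K.
  move=> /not_orP[h1 /negP]; rewrite -leNgt => h2; split => // i.
  have : ~ ([set x | g i x < a] `|` [set x | b < g i x]) x.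
    move=> h; apply: h1; rewrite -bigcup_seq /=; exists i => //=.
    by rewrite mem_index_enum.
  by move=> /not_orP[/negP + /negP]; rewrite -!leNgt => -> ->.
have mp i : measurable_fun setT (fun x => if x \in bad then 1 else g i x).
  apply: measurable_fun_if => //.
    apply: (measurable_fun_bool true); rewrite setTI.
    rewrite (_ : _ @^-1` _ = bad)//; apply/seteqP; split => x /=.
      by move=> h; apply/set_mem.
    by move=> h; apply/mem_set.
  exact: measurable_funTS.
exists (fun i x => if x \in bad then 1 else g i x); split => //.
- move=> i x; case: ifPn => [_|]; first by rewrite (a1 i) (b1 i).
  by rewrite notin_setE => /goodP[].
- move=> x; case: (boolP (x \in bad)) => [_|]; first by [].
  by rewrite notin_setE => /goodP[].
- move=> i S mS; rewrite gE//; apply: ae_eq_integral => //.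
  - by apply/measurable_EFinP; exact: measurable_funTS.
  - apply/measurable_EFinP; apply: measurable_funTS; exact: mp.
  exists bad; split => // x /= h; apply: contrapT => xbad; apply: h => _.
  by rewrite memNset.
Qed.

End densities.

(** * Likelihood ratios of product laws and mixtures *)

Section change_of_measure.
Context d (T : measurableType d) (R : realType).
Variables (P P0 : probability T R) (r : T -> R).
Hypotheses (mr : measurable_fun setT r)
  (PE : forall S, measurable S -> P S = (\int[P0]_(x in S) (r x)%:E)%E).

Lemma integral_density (h : T -> \bar R) :
  measurable_fun setT h -> (forall x, (0 <= h x)%E) ->
  (\int[P]_x h x = \int[P0]_x (h x * (r x)%:E))%E.
Proof.
move=> mh h0.
have dom : P `<< P0.
  apply/null_content_dominatesP => S mS P0S; rewrite PE//.
  by apply: null_set_integral => //; apply/measurable_EFinP; exact: measurable_funTS.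
rewrite -(Radon_Nikodym_SigmaFinite.change_of_variables dom)//.
have If := Radon_Nikodym_SigmaFinite.f_integrable dom.
apply: ae_eq_integral => //.
- by apply: emeasurable_funM => //; exact: measurable_int If.
- by apply: emeasurable_funM => //; exact/measurable_EFinP.
have : ae_eq P0 setT (Radon_Nikodym_SigmaFinite.f P P0) (EFin \o r).
  apply: integral_ae_eq => //; first exact/measurable_EFinP.
  by move=> S _ mS; rewrite -(Radon_Nikodym_SigmaFinite.f_integral dom)//; exact: PE.
by apply: filterS => x /= fr Dx; rewrite fr.
Qed.

End change_of_measure.

Section likelihood.
Variable R : realType.

(** The recursion follows the nested pairs of [views]. *)
Fixpoint likelihood n :
    forall Z : 'I_n -> mspace, (forall i, Z i -> R) -> views Z -> R :=
  match n with
  | 0%N => fun _ _ _ => 1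
  | _.+1 => fun Z r z =>
      r ord0 z.1 * likelihood (fun i => r (lift ord0 i)) z.2
  end.

Lemma measurable_likelihood n (Z : 'I_n -> mspace) (r : forall i, Z i -> R) :
  (forall i, measurable_fun setT (r i)) -> measurable_fun setT (likelihood r).
Proof.
elim: n Z r => [|n IH] Z r mr /=; first exact: measurable_cst.
apply: measurable_funM.
  exact: (measurableT_comp (mr ord0) measurable_fst).
have mL := IH _ _ (fun i => mr (lift ord0 i)).
exact: (measurableT_comp mL measurable_snd).
Qed.

Lemma likelihood_ge0 n (Z : 'I_n -> mspace) (r : forall i, Z i -> R) :
  (forall i x, 0 <= r i x) -> forall z, 0 <= likelihood r z.
Proof.
elim: n Z r => [|n IH] Z r r0 //= z; apply: mulr_ge0 => //.
by apply: IH => i x; exact: r0.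
Qed.

Lemma likelihoodM n (Z : 'I_n -> mspace) (r r' : forall i, Z i -> R) z :
  likelihood r z * likelihood r' z = likelihood (fun i x => r i x * r' i x) z.
Proof.
elim: n Z r r' z => [|n IH] Z r r' z /=; first by rewrite mulr1.
by rewrite mulrACA IH.
Qed.

Lemma integral_likelihood n (Z : 'I_n -> mspace)
    (P0 : forall i, probability (Z i) R) (r : forall i, Z i -> R) :
  (forall i, measurable_fun setT (r i)) -> (forall i x, 0 <= r i x) ->
  (\int[prod_prob P0]_z (likelihood r z)%:E =
   \big[*%E/1%E]_(i < n) \int[P0 i]_x (r i x)%:E)%E.
Proof.
elim: n Z P0 r => [|n IH] Z P0 r mr r0 /=.
  by rewrite big_ord0 integral_cst// mul1e; exact: probability_setT.
have mL : measurable_fun setT (likelihood (fun i => r (lift ord0 i))).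
  exact: measurable_likelihood.
have L0 z : 0 <= likelihood (fun i => r (lift ord0 i)) z.
  exact: likelihood_ge0.
rewrite fubini_tonelli1/=; last 2 first.
- apply/measurable_EFinP; apply: measurable_funM.
    exact: (measurableT_comp (mr ord0) measurable_fst).
  exact: (measurableT_comp mL measurable_snd).
- by move=> z; rewrite lee_fin mulr_ge0.
rewrite big_ord_recl -IH//; rewrite /fubini_F/=.
under eq_integral => x _.
  under eq_integral do rewrite EFinM.
  rewrite ge0_integralZl//; last 3 first.
  - exact/measurable_EFinP.
  - by move=> z _; rewrite lee_fin.
  - by rewrite lee_fin.
  rewrite muleC; over.
rewrite ge0_integralZl//.
- by rewrite muleC.
- exact/measurable_EFinP.
- by move=> x _; rewrite lee_fin.
- by apply: integral_ge0 => z _; rewrite lee_fin.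
Qed.

Lemma prod_prob_likelihood n (Z : 'I_n -> mspace)
    (P P0 : forall i, probability (Z i) R) (r : forall i, Z i -> R) :
  (forall i, measurable_fun setT (r i)) -> (forall i x, 0 <= r i x) ->
  (forall i S, measurable S -> P i S = (\int[P0 i]_(x in S) (r i x)%:E)%E) ->
  forall S, measurable S ->
  prod_prob P S = (\int[prod_prob P0]_(z in S) (likelihood r z)%:E)%E.
Proof.
elim: n Z P P0 r => [|n IH] Z P P0 r mr r0 PE /= S mS.
  by rewrite integral_cst// mul1e.
have mL : measurable_fun setT (likelihood (fun i => r (lift ord0 i))).
  exact: measurable_likelihood.
have L0 z : 0 <= likelihood (fun i => r (lift ord0 i)) z.
  exact: likelihood_ge0.
have mrL : measurable_fun setT (fun z : Z ord0 * views (fun i => Z (lift ord0 i)) =>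
    (r ord0 z.1 * likelihood (fun i => r (lift ord0 i)) z.2)%:E).
  apply/measurable_EFinP; apply: measurable_funM.
    exact: (measurableT_comp (mr ord0) measurable_fst).
  exact: (measurableT_comp mL measurable_snd).
rewrite integral_mkcond fubini_tonelli1/=; last 2 first.
- by apply/(measurable_restrictT _ mS); exact: measurable_funTS.
- by move=> z; rewrite patchE; case: ifP => // _; rewrite lee_fin mulr_ge0.
rewrite /product_measure1/= (integral_density (mr ord0) (PE ord0))//.
  apply: eq_integral => x _; rewrite /fubini_F/=.
  rewrite [RHS](eq_integral ((fun y => ((r ord0 x)%:E *
      (likelihood (fun i => r (lift ord0 i)) y)%:E)%E) \_ (xsection S x))).
    have mx : measurable (xsection S x) by exact: measurable_xsection.
    rewrite -integral_mkcond ge0_integralZl//.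
    - rewrite muleC; congr (_ * _)%E.
      by apply: IH => // i; exact: PE.
    - by apply/measurable_EFinP; exact: measurable_funTS.
    - by move=> y _; rewrite lee_fin.
    - by rewrite lee_fin.
  by move=> y _; rewrite !patchE mem_xsection.
exact: measurable_fun_xsection.
Qed.

End likelihood.

Section chi_square.
Context d (T : measurableType d) (R : realType) (mu : probability T R).

(** Integrate L <= 1 + eta/2 + (L-1)^2 / (2 eta), an instance of the inequality
    between arithmetic and geometric means, over D; the integral of (L-1)^2 over
    the whole space is at most X. *)
Lemma chi_square_event (L : T -> R) (D : set T) (gamma eta X : R) :
  measurable_fun setT L -> (forall x, 0 <= L x) ->
  (\int[mu]_x (L x)%:E = 1)%E -> (\int[mu]_x (L x ^+ 2)%:E <= (1 + X)%:E)%E ->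
  measurable D -> (mu D <= gamma%:E)%E -> 0 < eta ->
  (\int[mu]_(x in D) (L x)%:E <= ((1 + eta / 2) * gamma + X / (2 * eta))%:E)%E.
Proof.
move=> mL L0 L1 L2 mD Dg eta0.
pose V x := (L x - 1) ^+ 2.
have mV : measurable_fun setT V by apply: measurable_funX; exact: measurable_funB.
have V0 x : 0 <= V x by exact: sqr_ge0.
have VX : (\int[mu]_x (V x)%:E <= X%:E)%E.
  have : (\int[mu]_x (V x)%:E + 2%:E * \int[mu]_x (L x)%:E =
          \int[mu]_x (L x ^+ 2)%:E + \int[mu]_x (cst 1 x)%:E)%E.
    have mLE : measurable_fun setT (fun x => (L x)%:E) by exact/measurable_EFinP.
    have mVE : measurable_fun setT (fun x => (V x)%:E) by exact/measurable_EFinP.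
    have mL2E : measurable_fun setT (fun x => (L x ^+ 2)%:E).
      by apply/measurable_EFinP; exact: measurable_funX.
    have m2LE : measurable_fun setT (fun x => (2%:E * (L x)%:E)%E).
      by apply/measurable_EFinP; exact: measurable_funM.
    have L0E x : setT x -> (0 <= (L x)%:E)%E by rewrite lee_fin.
    have V0E x : setT x -> (0 <= (V x)%:E)%E by rewrite lee_fin.
    have L20E x : setT x -> (0 <= (L x ^+ 2)%:E)%E by rewrite lee_fin sqr_ge0.
    have L20E' x : setT x -> (0 <= 2%:E * (L x)%:E)%E.
      by move=> _; rewrite mule_ge0// lee_fin.
    rewrite -ge0_integralZl// -!ge0_integralD//; last exact/measurable_EFinP.
    apply: eq_integral => x _; rewrite -EFinM -!EFinD; congr EFin.
    by rewrite /V/=; ring.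
  have -> : (\int[mu]_x (cst 1 x)%:E = 1)%E.
    transitivity (1%:E * mu setT)%E; first exact: (integral_cst mu measurableT 1%:E).
    by rewrite probability_setT mule1.
  rewrite L1 mule1 => h.
  have : (\int[mu]_x (V x)%:E + 2%:E <= X%:E + 2%:E)%E.
    rewrite h -EFinD; apply: le_trans (_ : _ <= (1 + X)%:E + 1%:E)%E _.
      by rewrite leeD2r.
    by rewrite -EFinD lee_fin; lra.
  by rewrite leeD2rE.
have LV x : L x <= (1 + eta / 2) + (2 * eta)^-1 * V x.
  have := sqr_ge0 (L x - 1 - eta).
  rewrite -subr_ge0 => h.
  rewrite -(ler_pM2l (_ : 0 < 2 * eta)) ?mulr_gt0// mulrDr mulrA.
  rewrite divff ?mul1r ?gt_eqF ?mulr_gt0//.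
  by rewrite /V; nra.
apply: (@le_trans _ _ (\int[mu]_(x in D)
    ((cst (1 + eta / 2) x)%:E + (2 * eta)^-1%:E * (V x)%:E))%E).
  apply: ge0_le_integral => //.
  - by move=> x _; rewrite lee_fin.
  - by apply: measurable_funTS; exact/measurable_EFinP.
  - apply: measurable_funTS; apply/measurable_EFinP; apply: measurable_funD => //.
    exact: measurable_funM.
  - by move=> x _; rewrite -EFinM -EFinD lee_fin.
rewrite ge0_integralD//; last 4 first.
- by move=> x _; rewrite lee_fin /=; lra.
- exact/measurable_EFinP.
- by move=> x _; rewrite -EFinM lee_fin mulr_ge0// invr_ge0; lra.
- by apply: measurable_funTS; apply/measurable_EFinP; exact: measurable_funM.
rewrite [leRHS]EFinD; apply: leeD.
  apply: (@le_trans _ _ ((1 + eta / 2)%:E * mu D)%E).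
    rewrite (_ : integral _ _ _ = ((1 + eta / 2)%:E * mu D)%E)//.
    exact: (integral_cst mu mD (1 + eta / 2)%:E).
  rewrite EFinM lee_wpmul2l// lee_fin; lra.
rewrite ge0_integralZl//; last 3 first.
- by apply: measurable_funTS; exact/measurable_EFinP.
- by move=> x _; rewrite lee_fin.
- by rewrite lee_fin invr_ge0; lra.
rewrite [X / _]mulrC EFinM lee_wpmul2l//; first by rewrite lee_fin invr_ge0; lra.
apply: le_trans VX; apply: ge0_subset_integral => //.
- exact/measurable_EFinP.
- by move=> x _; rewrite lee_fin.
Qed.

End chi_square.

(** The uniform mixture over G of the alternative laws has a likelihood ratio
    whose second moment is the average of the products of the q a a' i.  If
    every alternative escaped the test with probability at most beta, the mixture
    would give mass at least 1 - beta to D, which [chi_square_event] bounds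
    from above. *)
Lemma mixture_error (R : realType) n (Z : 'I_n -> mspace)
    (P0 : forall i, probability (Z i) R) (I : finType) (G : pred I)
    (P : I -> forall i, probability (Z i) R) (r : I -> forall i, Z i -> R)
    (q : I -> I -> 'I_n -> R) (D : set (views Z)) (gamma beta eta X : R) :
  (forall a i, measurable_fun setT (r a i)) ->
  (forall a, G a -> forall i x, 0 <= r a i x) ->
  (forall a, G a -> forall i S, measurable S ->
    P a i S = (\int[P0 i]_(x in S) (r a i x)%:E)%E) ->
  (forall a a', G a -> G a' -> forall i,
    (\int[P0 i]_x (r a i x * r a' i x)%:E = (q a a' i)%:E)%E) ->
  (0 < #|G|)%N ->
  \sum_(a | G a) \sum_(a' | G a') \prod_i q a a' i <= (1 + X) * #|G|%:R ^+ 2 ->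
  measurable D -> (prod_prob P0 D <= gamma%:E)%E -> 0 < eta ->
  (forall a, G a -> (prod_prob (P a) (~` D) <= beta%:E)%E) ->
  1 <= beta + ((1 + eta / 2) * gamma + X / (2 * eta)).
Proof.
move=> mr r0 PE qE G0 sumq mD Dg eta0 PD.
pose g : R := #|G|%:R.
have g0 : 0 < g by rewrite ltr0n.
pose L z := \sum_(a | G a) g^-1 * likelihood (r a) z.
have mLa a : measurable_fun setT (likelihood (r a)) by exact: measurable_likelihood.
have La0 a z : G a -> 0 <= likelihood (r a) z.
  by move=> Ga; apply: likelihood_ge0; exact: r0.
have Lsum (S : set (views Z)) : measurable S ->
    (\int[prod_prob P0]_(z in S) (L z)%:E =
     \sum_(a | G a) g^-1%:E * prod_prob (P a) S)%E.
  move=> mS; under eq_integral do rewrite -sumEFin big_mkcond/=.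
  rewrite ge0_integral_sum//.
  - rewrite [RHS]big_mkcond/=; apply: eq_bigr => a _; case: (boolP (G a)) => Ga.
      under eq_integral do rewrite EFinM.
      rewrite ge0_integralZl//.
      + by rewrite (prod_prob_likelihood (mr a) (r0 a Ga) (PE a Ga)).
      + by apply: measurable_funTS; exact/measurable_EFinP.
      + by move=> x _; rewrite lee_fin La0.
      + by rewrite lee_fin invr_ge0 ltW.
    by rewrite integral0.
  - move=> a; case: (boolP (G a)) => Ga; last exact: measurable_cst.
    by apply: measurable_funTS; apply/measurable_EFinP; exact: measurable_funM.
  - move=> a x _; case: (boolP (G a)) => Ga //.
    by rewrite lee_fin mulr_ge0 ?La0// invr_ge0 ltW.
have sumg : \sum_(a | G a) g^-1 = 1 :> R.
  by rewrite sumr_const -mulr_natl divff// gt_eqF.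
have L0 z : 0 <= L z.
  by apply: sumr_ge0 => a Ga; rewrite mulr_ge0 ?La0// invr_ge0 ltW.
have mL : measurable_fun setT L.
  rewrite /L; under eq_fun do rewrite big_mkcond/=.
  apply: measurable_sum => a; case: (G a) => //.
  exact: measurable_funM.
have L1 : (\int[prod_prob P0]_z (L z)%:E = 1)%E.
  rewrite Lsum//; under eq_bigr do rewrite probability_setT mule1.
  by rewrite sumEFin sumg.
have L2 : (\int[prod_prob P0]_z (L z ^+ 2)%:E <= (1 + X)%:E)%E.
  have L2E z : L z ^+ 2 = \sum_(a | G a) \sum_(a' | G a')
      g^-1 ^+ 2 * likelihood (fun i x => r a i x * r a' i x) z.
    rewrite expr2 /L mulr_suml; apply: eq_bigr => a _.
    rewrite mulr_sumr; apply: eq_bigr => a' _.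
    by rewrite mulrACA likelihoodM expr2.
  have Laa a a' z : G a -> G a' -> 0 <= likelihood (fun i x => r a i x * r a' i x) z.
    by move=> Ga Ga'; rewrite -likelihoodM mulr_ge0// La0.
  have mLL a a' : measurable_fun setT (likelihood (fun i x => r a i x * r a' i x)).
    by apply: measurable_likelihood => i; exact: measurable_funM.
  pose W a a' z := if G a && G a' then
    g^-1 ^+ 2 * likelihood (fun i x => r a i x * r a' i x) z else 0.
  pose w a a' := if G a && G a' then g^-1 ^+ 2 * \prod_i q a a' i else 0.
  rewrite (eq_integral (fun z => \sum_a \sum_b (W a b z)%:E)%E); last first.
    move=> z _; rewrite L2E -sumEFin big_mkcond/=; apply: eq_bigr => a _.
    rewrite /W; case: (boolP (G a)) => Ga /=; last by rewrite big1.
    rewrite -sumEFin big_mkcond/=; apply: eq_bigr => b _.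
    by case: (G b).
  have W0 a b z : (0 <= (W a b z)%:E)%E.
    rewrite /W; case: ifPn => // /andP[Ga Gb].
    by rewrite lee_fin mulr_ge0 ?Laa// sqr_ge0.
  have mW a b : measurable_fun setT (fun z => (W a b z)%:E).
    rewrite /W; case: (G a && G b) => //; apply/measurable_EFinP.
    exact: measurable_funM.
  rewrite ge0_integral_sum//; last 2 first.
  - by move=> a; exact: emeasurable_sum.
  - by move=> a z _; exact: sume_ge0.
  have WE a b : (\int[prod_prob P0]_z (W a b z)%:E = (w a b)%:E)%E.
    rewrite /W /w; case: (boolP (G a && G b)) => [/andP[Ga Gb]|_]; last first.
      by rewrite integral0.
    under eq_integral do rewrite EFinM.
    rewrite ge0_integralZl//.
    - rewrite integral_likelihood//.
      + by rewrite (eq_bigr _ (fun i _ => qE a b Ga Gb i)) prodEFin.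
      + by move=> i; exact: measurable_funM.
      + by move=> i x; rewrite mulr_ge0// r0.
    - exact/measurable_EFinP.
    - by move=> z _; rewrite lee_fin Laa.
    - by rewrite lee_fin sqr_ge0.
  rewrite [leLHS](_ : _ = (\sum_a \sum_b w a b)%:E); last first.
    rewrite -sumEFin; apply: eq_bigr => a _.
    rewrite ge0_integral_sum// -sumEFin.
    by apply: eq_bigr => b _; exact: WE.
  rewrite lee_fin.
  have -> : \sum_a \sum_b w a b =
      g^-1 ^+ 2 * \sum_(a | G a) \sum_(b | G b) \prod_i q a b i.
    rewrite mulr_sumr [RHS]big_mkcond/=; apply: eq_bigr => a _.
    rewrite /w; case: (boolP (G a)) => Ga /=; last by rewrite big1.
    by rewrite mulr_sumr [RHS]big_mkcond/=.
  rewrite exprVn mulrC ler_pdivrMr ?exprn_gt0//.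
have := chi_square_event mL L0 L1 L2 mD Dg eta0.
rewrite Lsum// => h.
have : ((1 - beta)%:E <= \sum_(a | G a) g^-1%:E * prod_prob (P a) D)%E.
  rewrite -[(1 - beta)]mul1r -sumg mulr_suml -sumEFin; apply: lee_sum => a Ga.
  rewrite EFinM lee_wpmul2l//; first by rewrite lee_fin invr_ge0 ltW.
  have := PD a Ga; rewrite probability_setC//.
  rewrite -[prod_prob (P a) D]fineK ?fin_num_measure//.
  by move: (fine _) => p; rewrite -EFinB !lee_fin; lra.
move=> /le_trans/(_ h); rewrite lee_fin; lra.
Qed.

(** * Dyadic intervals and Haar wavelets *)

Section dyadic.
Variable R : realType.
Implicit Types (j k m : nat) (x : R).

Definition dyadic j m : set R :=
  [set` `[m%:R / 2 ^+ j, m.+1%:R / 2 ^+ j[%R].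

Lemma dyadicP j m x : dyadic j m x <-> (m%:R <= 2 ^+ j * x < m.+1%:R).
Proof.
rewrite /dyadic /= in_itv/= ler_pdivrMr ?ltr_pdivlMr ?exprn_gt0//.
by rewrite mulrC.
Qed.

Lemma measurable_dyadic j m : measurable (dyadic j m).
Proof. exact: measurable_itv. Qed.

Lemma lebesgue_measure_dyadic j m :
  lebesgue_measure (dyadic j m) = (2 ^- j)%:E.
Proof.
rewrite /dyadic lebesgue_measure_itv/= lte_fin ltr_pM2r ?invr_gt0 ?exprn_gt0//.
by rewrite ltr_nat ltnSn -EFinB -mulrBl -natrB// subSnn mul1r.
Qed.

Lemma dyadic_sub01 j m : (m < 2 ^ j)%N -> dyadic j m `<=` I01 R.
Proof.
move=> mj x /dyadicP/andP[x0 x1]; rewrite /= in_itv/=.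
have p0 : 0 < 2 ^+ j :> R by rewrite exprn_gt0.
apply/andP; split; first by rewrite -(pmulr_rge0 _ p0) (le_trans _ x0).
rewrite -(ler_pM2l p0) mulr1 (le_trans (ltW x1))// -natrX ler_nat.
exact: mj.
Qed.

Lemma dyadic_inj j m m' x : dyadic j m x -> dyadic j m' x -> m = m'.
Proof.
move=> /dyadicP/andP[a b] /dyadicP/andP[c d]; apply/eqP.
rewrite eqn_leq -!(ltnS m) -!(ltnS m') -!(ltr_nat R).
by rewrite (le_lt_trans a d) (le_lt_trans c b).
Qed.

(** A dyadic interval is either disjoint from an interval of a level at least
    as fine or contains it, so membership in it is constant on the latter. *)
Lemma dyadic_nested j j' m m' x y : (j <= j')%N ->
  dyadic j' m' x -> dyadic j' m' y -> dyadic j m x -> dyadic j m y.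
Proof.
move=> jj' /dyadicP/andP[x1 x2] /dyadicP/andP[y1 y2] /dyadicP/andP[h1 h2].
have e : 2 ^+ j' = 2 ^+ (j' - j) * 2 ^+ j :> R by rewrite -exprD subnK.
have p0 : 0 < 2 ^+ (j' - j) :> R by rewrite exprn_gt0.
rewrite e -mulrA in x1; rewrite e -mulrA in x2.
rewrite e -mulrA in y1; rewrite e -mulrA in y2.
apply/dyadicP; apply/andP; split.
  rewrite -(ler_pM2l p0) (le_trans _ y1)// -natrX -natrM ler_nat -ltnS.
  rewrite -(ltr_nat R) natrM natrX (le_lt_trans _ x2)//.
  by rewrite ler_pM2l.
rewrite -(ltr_pM2l p0) (lt_le_trans y2)// -natrX -natrM ler_nat.
rewrite -(ltr_nat R) natrM natrX (le_lt_trans x1)//.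
by rewrite ltr_pM2l.
Qed.

Lemma dyadic_half j m x : dyadic j.+1 m x -> dyadic j m./2 x.
Proof.
move=> /dyadicP; rewrite exprS -mulrA => /andP[x1 x2]; apply/dyadicP.
have := odd_double_half m; set h := m./2 => mE.
have h1 : 2 * h%:R <= m%:R :> R by rewrite -natrM ler_nat -mE mul2n leq_addl.
have h2 : m.+1%:R <= 2 * h.+1%:R :> R.
  by rewrite -natrM ler_nat mul2n doubleS -mE; case: (odd m).
by apply/andP; split; lra.
Qed.

Lemma indic_dyadicM j m m' x : m != m' ->
  \1_(dyadic j m) x * \1_(dyadic j m') x = 0 :> R.
Proof.
move=> mm'; rewrite !indicE; case: (boolP (x \in dyadic j m)) => [|_]; last first.
  by rewrite mul0r.
rewrite inE => xm; case: (boolP (x \in dyadic j m')); last by rewrite mulr0.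
by rewrite inE => xm'; move: mm'; rewrite (dyadic_inj xm xm') eqxx.
Qed.

Lemma indic_dyadic_idem j m x :
  \1_(dyadic j m) x * \1_(dyadic j m) x = \1_(dyadic j m) x :> R.
Proof. by rewrite indicE -natrM mulnb andbb. Qed.

Lemma haarE j k x : haar (2 ^+ j * x - k%:R) =
  \1_(dyadic j.+1 k.*2) x - \1_(dyadic j.+1 k.*2.+1) x.
Proof.
have e0 : k.*2%:R = 2 * k%:R :> R by rewrite -mul2n natrM.
have e1 : k.*2.+1%:R = 2 * k%:R + 1 :> R by rewrite -addn1 natrD e0.
have e2 : k.*2.+2%:R = 2 * k%:R + 2 :> R by rewrite -addn2 natrD e0.
rewrite /haar !indicE; congr ((_ : bool)%:R - (_ : bool)%:R);
  apply/idP/idP; rewrite !inE.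
- rewrite /= in_itv/= => /andP[a b]; apply/dyadicP; rewrite exprS e0 e1.
  by apply/andP; split; lra.
- move=> /dyadicP; rewrite exprS e0 e1 => /andP[a b].
  by rewrite /= in_itv/=; apply/andP; split; lra.
- rewrite /= in_itv/= => /andP[a b]; apply/dyadicP; rewrite exprS e1 e2.
  by apply/andP; split; lra.
- move=> /dyadicP; rewrite exprS e1 e2 => /andP[a b].
  by rewrite /= in_itv/=; apply/andP; split; lra.
Qed.

End dyadic.

Arguments dyadic : clear implicits.

Section wavelets.
Variable R : realType.
Implicit Types (j k m : nat) (x : R).
Local Notation mu := (@lebesgue_measure R).

Lemma integrable01 (f : R -> R) (K : R) :
  measurable_fun setT f -> (forall x, `|f x| <= K) ->
  mu.-integrable (I01 R) (EFin \o f).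
Proof.
move=> mf fK; apply: measurable_bounded_integrable => //.
- by rewrite /= lebesgue_measure_itv/= lte_fin ltr01 -EFinB ltry.
- exact: measurable_funTS.
- by exists K; split; [exact: num_real|move=> y /ltW Ky x _; exact: le_trans (fK x) Ky].
Qed.

Definition wavelet j k x : R := 2 `^ (j%:R / 2) * haar (2 ^+ j * x - k%:R).

Lemma sqr_pow_half j : (2 `^ (j%:R / 2)) ^+ 2 = 2 ^+ j :> R.
Proof.
rewrite -powR_mulrn ?powR_ge0// -powRrM -powR_mulrn//.
by congr (_ `^ _); rewrite divfK.
Qed.

Lemma haar_norm_le1 x : `|haar x| <= 1.
Proof.
rewrite /haar !indicE; case: (_ \in _); case: (_ \in _) => /=;
  rewrite ?subrr ?subr0 ?sub0r ?normrN ?normr0 ?normr1 //.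
Qed.

Lemma wavelet_norm j k x : `|wavelet j k x| <= 2 `^ (j%:R / 2).
Proof.
rewrite /wavelet normrM ger0_norm ?powR_ge0//.
by rewrite -[leRHS]mulr1 ler_wpM2l ?powR_ge0// haar_norm_le1.
Qed.

Lemma waveletE j k x : wavelet j k x = 2 `^ (j%:R / 2) *
  (\1_(dyadic R j.+1 k.*2) x - \1_(dyadic R j.+1 k.*2.+1) x).
Proof. by rewrite /wavelet haarE. Qed.

Lemma wavelet_supp j k x : ~ dyadic R j k x -> wavelet j k x = 0.
Proof.
move=> xk; rewrite waveletE !indicE !memNset ?subrr ?mulr0//.
  by move=> /dyadic_half; rewrite /= uphalf_double.
by move=> /dyadic_half; rewrite doubleK.
Qed.

Lemma measurable_wavelet j k : measurable_fun setT (wavelet j k).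
Proof.
rewrite (funext (waveletE j k)); apply: measurable_funM => //.
apply: measurable_funB; apply: measurable_indic; exact: measurable_dyadic.
Qed.

Lemma integrable_indic01 j m (c : R) :
  mu.-integrable (I01 R) (EFin \o (fun x => c * \1_(dyadic R j m) x)).
Proof.
apply: (integrable01 (K := `|c|)).
  by apply: measurable_funM => //; apply: measurable_indic; exact: measurable_dyadic.
move=> x; rewrite normrM -[leRHS]mulr1 ler_wpM2l//.
by rewrite indicE; case: (_ \in _); rewrite ?normr0 ?normr1.
Qed.

Lemma Rintegral_indic_dyadic j m : (m < 2 ^ j)%N ->
  \int[mu]_(x in I01 R) \1_(dyadic R j m) x = 2 ^- j.
Proof.
move=> mj; rewrite /Rintegral integral_indic//; last exact: measurable_dyadic.
rewrite (setIidl (@dyadic_sub01 R _ _ mj)). by rewrite /= lebesgue_measure_dyadic.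
Qed.

Lemma integral_wavelet j k : (k < 2 ^ j)%N ->
  \int[mu]_(x in I01 R) wavelet j k x = 0.
Proof.
move=> kj; under eq_Rintegral do rewrite waveletE.
have i1 m : mu.-integrable (I01 R) (EFin \o (\1_(dyadic R j.+1 m) : R -> R)).
  have := integrable_indic01 j.+1 m 1; apply: eq_integrable => // x _ /=.
  by rewrite mul1r.
rewrite RintegralZl//; last first.
  by have := integrableB _ (i1 k.*2) (i1 k.*2.+1); apply.
rewrite RintegralB// !Rintegral_indic_dyadic ?subrr ?mulr0//.
  by rewrite expnS; lia.
by rewrite expnS; lia.
Qed.

(** Across levels, the coarser wavelet is constant on the support of the finer
    one, whose integral vanishes; within a level the supports are disjoint. *)
Lemma wavelet_orthonormal j k j' k' : (k < 2 ^ j)%N -> (k' < 2 ^ j')%N ->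
  \int[mu]_(x in I01 R) (wavelet j k x * wavelet j' k' x)
  = ((j == j') && (k == k'))%:R.
Proof.
wlog jj' : j k j' k' / (j <= j')%N.
  move=> h kj kj'; have [jj'|/ltnW jj'] := leqP j j'; first exact: h.
  rewrite eq_sym [k == _]eq_sym -h//.
  by apply: eq_Rintegral => x _; rewrite mulrC.
move=> kj kj'; have [<-|jnj'] := eqVneq j j' => /=; last first.
  have {}jj' : (j < j')%N by rewrite ltn_neqAle jnj'.
  (* The left end of the support of the finer wavelet. *)
  pose x0 : R := k'%:R / 2 ^+ j'.
  have x0k : dyadic R j' k' x0.
    apply/dyadicP; rewrite /x0 mulrC divfK ?expf_neq0// lexx/=.
    by rewrite ltr_nat.
  rewrite (@eq_Rintegral _ _ _ mu (I01 R) (fun x => wavelet j k x0 * wavelet j' k' x)).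
    rewrite RintegralZl ?integral_wavelet ?mulr0//.
    by apply: integrable01; [exact: measurable_wavelet|exact: wavelet_norm].
  move=> x _; have [xk|xk] := pselect (dyadic R j' k' x).
    congr (_ * _); rewrite !waveletE !indicE.
    congr (_ * ((_ : bool)%:R - (_ : bool)%:R)).
      by apply/idP/idP; rewrite !inE;
        [exact: dyadic_nested xk x0k|exact: dyadic_nested x0k xk].
    by apply/idP/idP; rewrite !inE;
        [exact: dyadic_nested xk x0k|exact: dyadic_nested x0k xk].
  by rewrite (wavelet_supp xk) !mulr0.
have i1 m : mu.-integrable (I01 R) (EFin \o (\1_(dyadic R j.+1 m) : R -> R)).
  have := integrable_indic01 j.+1 m 1; apply: eq_integrable => // x _ /=.
  by rewrite mul1r.
have prodE x : wavelet j k x * wavelet j k' x = 2 ^+ j *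
    ((\1_(dyadic R j.+1 k.*2) x - \1_(dyadic R j.+1 k.*2.+1) x) *
     (\1_(dyadic R j.+1 k'.*2) x - \1_(dyadic R j.+1 k'.*2.+1) x)).
  by rewrite !waveletE mulrACA -expr2 sqr_pow_half.
have [kk'|kk'] := eqVneq k k'; last first.
  rewrite (@eq_Rintegral _ _ _ mu (I01 R) (fun=> 0)).
    by rewrite Rintegral_cst ?mul0r.
  move=> x _; rewrite prodE mulrBl !mulrBr !indic_dyadicM ?subrr ?mulr0//; lia.
rewrite (@eq_Rintegral _ _ _ mu (I01 R) (fun x => 2 ^+ j *
    (\1_(dyadic R j.+1 k.*2) x + \1_(dyadic R j.+1 k.*2.+1) x))); last first.
  move=> x _; rewrite prodE -kk'; congr (_ * _).
  rewrite mulrBl !mulrBr !indic_dyadic_idem !indic_dyadicM; [by ring|lia|lia].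
rewrite RintegralZl//; last first.
  by have := integrableD _ (i1 k.*2) (i1 k.*2.+1); apply.
rewrite RintegralD// !Rintegral_indic_dyadic; last 2 first.
- by rewrite expnS; lia.
- by rewrite expnS; lia.
transitivity (1 : R); last by [].
by rewrite exprS invfM; field; exact: expf_neq0.
Qed.

End wavelets.

Section haar_series.
Variable R : realType.
Local Notation mu := (@lebesgue_measure R).

Lemma L2norm_bounded (f : R -> R) (K : R) :
  measurable_fun setT f -> (forall x, `|f x| <= K) ->
  L2 f /\ L2norm f = (Num.sqrt (\int[mu]_(x in I01 R) f x ^+ 2))%:E.
Proof.
move=> mf fK.
have I2 : mu.-integrable (I01 R) (EFin \o (fun x => f x ^+ 2)).
  apply: (integrable01 (K := K ^+ 2)); first exact: measurable_funX.
  by move=> x; rewrite normrX lerXn2r ?nnegrE// (le_trans _ (fK x)).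
have normE : L2norm f = (Num.sqrt (\int[mu]_(x in I01 R) f x ^+ 2))%:E.
  rewrite /L2norm unlock /=.
  rewrite (_ : integral _ _ _ = (\int[mu]_(x in I01 R) f x ^+ 2)%:E).
    rewrite poweR_EFin powR12_sqrt//.
    by apply: Rintegral_ge0 => x _; exact: sqr_ge0.
  rewrite fineK; last exact: (integrable_fin_num _ I2).
  rewrite [RHS]integral_mkcond; apply: eq_integral => x _ /=.
  have sqE (a : R) : `|a| `^ 2 = a ^+ 2.
    by rewrite powR_mulrn ?normr_ge0// real_normK ?num_real.
  by rewrite !patchE; case: ifP => _; rewrite sqE// expr0n.
split => //.
have mfr : measurable_fun setT (f \_ (I01 R)).
  by apply/(measurable_restrictT _ (measurable_itv _)); exact: measurable_funTS.
rewrite /L2/=; apply/andP; split; first by rewrite inE.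
rewrite inE /= /finite_norm; move: normE; rewrite /L2norm => ->.
exact: ltry.
Qed.

Variable J : nat.
Implicit Types c : 'I_(2 ^ J) -> R.

Definition haar_series c (x : R) : R := \sum_k c k * wavelet J k x.

Lemma measurable_haar_series c : measurable_fun setT (haar_series c).
Proof.
apply: measurable_sum => k; apply: measurable_funM => //.
exact: measurable_wavelet.
Qed.

(** At every point at most one term of the series is nonzero. *)
Lemma haar_series_le c (B : R) : 0 <= B ->
  (forall k, `|c k| * 2 `^ (J%:R / 2) <= B) ->
  forall x, `|haar_series c x| <= B.
Proof.
move=> B0 cB x.
have [[k xk]|nx] := pselect (exists k : 'I_(2 ^ J), dyadic R J k x); last first.
  rewrite /haar_series big1 ?normr0// => k _.
  by rewrite wavelet_supp ?mulr0// => xk; apply: nx; exists k.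
rewrite /haar_series (bigD1 k)//= big1 => [|l lk].
  rewrite addr0 normrM; apply: le_trans (cB k).
  by rewrite ler_wpM2l// wavelet_norm.
rewrite wavelet_supp ?mulr0// => xl; move/eqP: lk; apply; apply: val_inj.
exact: dyadic_inj xl xk.
Qed.

Lemma haar_series_bounded c : exists2 B, 0 <= B & forall x, `|haar_series c x| <= B.
Proof.
pose B : R := \sum_k `|c k| * 2 `^ (J%:R / 2).
have B0 : 0 <= B by apply: sumr_ge0 => k _; rewrite mulr_ge0// powR_ge0.
exists B => //; apply: haar_series_le => // k.
rewrite /B (bigD1 k)//= lerDl; apply: sumr_ge0 => l _.
by rewrite mulr_ge0// powR_ge0.
Qed.

Lemma integrable_waveletM j k j' k' :
  mu.-integrable (I01 R) (EFin \o (fun x : R => wavelet j k x * wavelet j' k' x)).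
Proof.
apply: (integrable01 (K := 2 `^ (j%:R / 2) * 2 `^ (j'%:R / 2))).
  by apply: measurable_funM; exact: measurable_wavelet.
by move=> x; rewrite normrM ler_pM// wavelet_norm.
Qed.

Lemma integrableZ01 (a : R) (f : R -> R) :
  mu.-integrable (I01 R) (EFin \o f) ->
  mu.-integrable (I01 R) (EFin \o (fun x => a * f x)).
Proof. by apply: integrable_scale; exact: measurable_itv. Qed.

Lemma Rintegral_sum01 (I : finType) (f : I -> R -> R) :
  (forall i, mu.-integrable (I01 R) (EFin \o f i)) ->
  \int[mu]_(x in I01 R) \sum_i f i x = \sum_i \int[mu]_(x in I01 R) f i x.
Proof. by apply: Rintegral_fsum; exact: measurable_itv. Qed.

Lemma integrable_sum01 (I : finType) (f : I -> R -> R) :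
  (forall i, mu.-integrable (I01 R) (EFin \o f i)) ->
  mu.-integrable (I01 R) (EFin \o (fun x => \sum_i f i x)).
Proof. by apply: integrable_fsum; exact: measurable_itv. Qed.

Lemma series_wavelet c j k : (k < 2 ^ j)%N ->
  \int[mu]_(x in I01 R) (haar_series c x * wavelet j k x) =
  \sum_l c l * ((J == j) && (l == k :> nat))%:R.
Proof.
move=> kj.
transitivity (\int[mu]_(x in I01 R) \sum_l (c l * (wavelet J l x * wavelet j k x))).
  apply: eq_Rintegral => x _; rewrite mulr_suml.
  by apply: eq_bigr => l _; rewrite mulrA.
rewrite Rintegral_sum01 => [|l].
  apply: eq_bigr => l _; rewrite RintegralZl//; last exact: integrable_waveletM.
  by rewrite wavelet_orthonormal.
by apply: integrableZ01; exact: integrable_waveletM.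
Qed.

Lemma haar_coef_series c j k : (k < 2 ^ j)%N ->
  haar_coef j k (haar_series c) = \sum_l c l * ((J == j) && (l == k :> nat))%:R.
Proof.
move=> kj; rewrite -series_wavelet//; apply: eq_Rintegral => x _.
by rewrite /wavelet; ring.
Qed.

Lemma sum_sqr_haar_coef c j :
  \sum_(k < (2 ^ j)%N) haar_coef j k (haar_series c) ^+ 2 =
  if j == J then \sum_k c k ^+ 2 else 0.
Proof.
case: eqVneq => [->|jJ].
  apply: eq_bigr => k _; rewrite haar_coef_series// eqxx/= (bigD1 k)//= eqxx.
  by rewrite big1 ?addr0 ?mulr1// => l; rewrite -val_eqE /= => /negPf ->; rewrite mulr0.
apply: big1 => k _; rewrite haar_coef_series// eq_sym (negPf jJ)/=.
by rewrite big1 ?expr0n// => l _; rewrite mulr0.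
Qed.

Lemma haar_series_L2 c : L2 (haar_series c) /\
  L2norm (haar_series c) = (Num.sqrt (\sum_k c k ^+ 2))%:E.
Proof.
have [B _ gB] := haar_series_bounded c.
have [h ->] := L2norm_bounded (measurable_haar_series c) gB; split => //.
have Igw k : mu.-integrable (I01 R)
    (EFin \o (fun x : R => haar_series c x * wavelet J k x)).
  apply: (integrable01 (K := B * 2 `^ (J%:R / 2))).
    apply: measurable_funM; first exact: measurable_haar_series.
    exact: measurable_wavelet.
  by move=> x; rewrite normrM ler_pM// wavelet_norm.
congr (Num.sqrt _)%:E.
transitivity (\int[mu]_(x in I01 R) \sum_k c k * (haar_series c x * wavelet J k x)).
  apply: eq_Rintegral => x _; rewrite expr2 {2}/haar_series mulr_sumr.
  by apply: eq_bigr => k _; ring.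
rewrite Rintegral_sum01 => [|k].
  apply: eq_bigr => k _; rewrite RintegralZl//.
  rewrite series_wavelet// eqxx/= (bigD1 k)//= eqxx.
  rewrite big1 ?addr0 ?mulr1 ?expr2// => l.
  by rewrite -val_eqE /= => /negPf ->; rewrite mulr0.
by apply: integrableZ01; exact: Igw.
Qed.

Lemma integral_haar_series c : \int[mu]_(x in I01 R) haar_series c x = 0.
Proof.
rewrite Rintegral_sum01 => [|k].
  apply: big1 => k _; rewrite RintegralZl ?integral_wavelet ?mulr0//.
  by apply: integrable01; [exact: measurable_wavelet|exact: wavelet_norm].
apply: integrableZ01; apply: integrable01; first exact: measurable_wavelet.
exact: wavelet_norm.
Qed.

End haar_series.

(** * Haar perturbations of the uniform density *)

Section alternatives.
Variable R : realType.
Local Notation mu := (@lebesgue_measure R).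

Section cell.
Variables (j : nat) (m : 'I_(2 ^ j)).

Let cell (x : R) : R := 2 ^+ j * \1_(dyadic R j m) x.

Let measurable_cell : measurable_fun (I01 R) cell.
Proof.
apply: measurable_funTS; apply: measurable_funM => //.
by apply: measurable_indic; exact: measurable_dyadic.
Qed.

Let cell_ge0 x : I01 R x -> 0 <= cell x.
Proof. by move=> _; rewrite /cell mulr_ge0. Qed.

Let cell_mass : (\int[mu]_(x in I01 R) (cell x)%:E = 1)%E.
Proof.
have mI : measurable (I01 R) by exact: measurable_itv.
have Ic : mu.-integrable (I01 R) (EFin \o cell) by exact: integrable_indic01.
rewrite -[LHS]fineK; last exact: (integrable_fin_num mI Ic).
rewrite -[X in X%:E]/(\int[mu]_(x in I01 R) cell x) RintegralZl//.
  by rewrite Rintegral_indic_dyadic// divff// expf_neq0.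
have := integrable_indic01 j m (1 : R); apply: eq_integrable => // x _ /=.
by rewrite mul1r.
Qed.

Definition cell_density : density R :=
  Density measurable_cell cell_ge0 cell_mass.

End cell.

Lemma sum_indic_dyadic_le1 j (I : finType) (f : I -> nat) (x : R) :
  injective f -> \sum_i \1_(dyadic R j (f i)) x <= 1 :> R.
Proof.
move=> injf.
have [[m xm]|nx] := pselect (exists m, dyadic R j (f m) x); last first.
  rewrite big1 ?ler01// => m _; rewrite indicE memNset// => xm.
  by apply: nx; exists m.
rewrite (bigD1 m)//= big1 => [|l lm]; first by rewrite addr0 indicE; case: (_ \in _).
rewrite indicE memNset// => xl; move/eqP: lm; apply; apply: injf.
exact: dyadic_inj xl xm.
Qed.

Section alternative.
Variables (J : nat) (c : 'I_(2 ^ J) -> R).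
Hypothesis cB : forall k, `|c k| * 2 `^ (J%:R / 2) <= 1.

Let alt (x : R) : R := \1_(I01 R) x + haar_series c x.

Let measurable_alt : measurable_fun (I01 R) alt.
Proof.
apply: measurable_funTS; apply: measurable_funD.
  by apply: measurable_indic; exact: measurable_itv.
exact: measurable_haar_series.
Qed.

Let alt_ge0 x : I01 R x -> 0 <= alt x.
Proof.
move=> x01; rewrite /alt indicE mem_set//=.
have := haar_series_le ler01 cB x; rewrite ler_norml => /andP[h _].
by rewrite -lerBlDl sub0r.
Qed.

Let alt_mass : (\int[mu]_(x in I01 R) (alt x)%:E = 1)%E.
Proof.
have mI : measurable (I01 R) by exact: measurable_itv.
have Ih : mu.-integrable (I01 R) (EFin \o haar_series c).
  apply: (integrable01 (K := 1)); first exact: measurable_haar_series.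
  exact: haar_series_le.
have I1 : mu.-integrable (I01 R) (EFin \o (\1_(I01 R) : R -> R)).
  apply: (integrable01 (K := 1)); first by apply: measurable_indic; exact: measurable_itv.
  by move=> x; rewrite indicE; case: (_ \in _); rewrite ?normr0 ?normr1.
rewrite (eq_integral (fun x => (\1_(I01 R) x)%:E + (haar_series c x)%:E)%E)//.
rewrite (integralD _ I1 Ih)//.
rewrite (density_mass (uniform_density R)).
rewrite -[X in (_ + X)%E]fineK; last exact: (integrable_fin_num mI Ih).
rewrite -[X in (_ + X%:E)%E]/(\int[mu]_(x in I01 R) haar_series c x).
by rewrite integral_haar_series adde0.
Qed.

(** The condition on c keeps the series between -1 and 1, so adding it to the
    uniform density leaves a nonnegative function. *)
Definition alternative : density R :=
  Density measurable_alt alt_ge0 alt_mass.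

Lemma alternative_subE : alternative \- uniform_density R = haar_series c.
Proof.
by apply/funext => x /=; rewrite /alt addrAC subrr add0r.
Qed.

End alternative.

End alternatives.

(** * Scores of a private channel *)

Section channel.
Variables (R : realType) (n : nat) (Q : channel R n) (i : 'I_n).
Local Notation mu := (@lebesgue_measure R).
Local Notation view f := (@view_prob R n Q f i).

(** Integrate the likelihood-ratio bound first in the input distributed as f,
    then in the input distributed as g. *)
Lemma view_prob_le (alpha : R) (f g : density R) S : private alpha Q ->
  measurable S -> (view f S <= (expR alpha)%:E * view g S)%E.
Proof.
move=> priv mS.
have mQ : measurable_fun (I01 R) (fun x => privatize Q i x S).
  by apply: measurable_funTS; exact: measurable_kernel.
have mden (h : density R) : measurable_fun (I01 R) (fun x => (h x)%:E).
  by apply/measurable_EFinP; exact: density_measurable.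
have mI : measurable (I01 R) by exact: measurable_itv.
have h0 (h : density R) x : I01 R x -> (0 <= (h x)%:E)%E.
  by move=> x01; rewrite lee_fin; exact: density_ge0.
have Qh0 (h : density R) x : I01 R x -> (0 <= privatize Q i x S * (h x)%:E)%E.
  by move=> x01; rewrite mule_ge0// h0.
have pointwise x' : I01 R x' -> (view f S <= (expR alpha)%:E * privatize Q i x' S)%E.
  move=> x'01; rewrite -[leRHS]mule1 -(density_mass f) -ge0_integralZl//; last exact: h0.
  apply: ge0_le_integral => //.
  - exact: Qh0.
  - exact: emeasurable_funM.
  - by apply: emeasurable_funM => //; exact: measurable_cst.
  - by move=> x x01; rewrite lee_wpmul2r ?h0//; exact: priv.
rewrite -[leLHS]mule1 -(density_mass g) -ge0_integralZl//; last first.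
- exact: h0.
rewrite /view_prob -ge0_integralZl//; last 2 first.
- exact: emeasurable_funM.
- exact: Qh0.
apply: ge0_le_integral => //.
- by move=> x x01; rewrite mule_ge0 ?h0//; exact: (measure_ge0 (@view_prob R n Q f i)).
- by apply: emeasurable_funM => //; exact: measurable_cst.
- by apply: emeasurable_funM => //; exact: emeasurable_funM.
- by move=> x x01; rewrite muleA lee_wpmul2r ?h0//; exact: pointwise.
Qed.

Lemma kernel_fin (S : set (view_space Q i)) x :
  measurable S -> privatize Q i x S \is a fin_num.
Proof.
move=> mS; rewrite ge0_fin_numE//; apply: (@le_lt_trans _ _ 1%E); last exact: ltry.
by rewrite -(@prob_kernel _ _ _ _ _ (privatize Q i) x) le_measure// inE.
Qed.

Lemma integrable_view (S : set (view_space Q i)) (g : R -> R) (K : R) :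
  measurable S -> measurable_fun setT g -> (forall x, `|g x| <= K) ->
  mu.-integrable (I01 R) (EFin \o (fun x => fine (privatize Q i x S) * g x)).
Proof.
move=> mS mg gK; apply: (integrable01 (K := K)).
  apply: measurable_funM => //; have mK := measurable_kernel (privatize Q i) S mS.
  exact: (measurableT_comp (fine_measurable measurableT) mK).
move=> x; rewrite normrM -[leRHS]mul1r ler_pM//.
rewrite ger0_norm ?fine_ge0// -lee_fin fineK; last exact: kernel_fin.
by rewrite -(@prob_kernel _ _ _ _ _ (privatize Q i) x) le_measure// inE.
Qed.

Lemma view_probE (f : density R) (S : set (view_space Q i)) : measurable S ->
  view f S = (\int[mu]_(x in I01 R) (fine (privatize Q i x S) * f x))%:E.
Proof.
move=> mS.
have E : view f S = (\int[mu]_(x in I01 R) (fine (privatize Q i x S) * f x)%:E)%E.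
  apply: eq_integral => x _; rewrite EFinM fineK//; exact: kernel_fin.
rewrite /Rintegral -E fineK//.
exact: (fin_num_measure (@view_prob R n Q f i)).
Qed.

End channel.

Section channel_scores.
Variables (R : realType) (n : nat) (Q : channel R n) (i : 'I_n) (alpha : R).
Hypothesis priv : private alpha Q.
Variable J : nat.
Local Notation mu := (@lebesgue_measure R).
Local Notation view f := (@view_prob R n Q f i).
Local Notation P0 := (@view_prob R n Q (uniform_density R) i).
Implicit Types (k : 'I_(2 ^ J)) (kb : 'I_(2 ^ J) * bool).

Lemma half_index_proof kb : (kb.1.*2 + kb.2 < 2 ^ J.+1)%N.
Proof. by case: kb => [[k kJ] b] /=; rewrite expnS; case: b; lia. Qed.

(** The pair (k, b) stands for the left or right half of the dyadic interval
    (J, k), on which the wavelet (J, k) is constant. *)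
Definition half_index kb : 'I_(2 ^ J.+1) := Ordinal (half_index_proof kb).

Lemma half_index_inj : injective (fun kb => nat_of_ord (half_index kb)).
Proof.
move=> [k b] [k' b'] /= e.
have bb : b = b' by move: (congr1 odd e); rewrite !oddD !odd_double; case: b e; case: b'.
rewrite -bb in e *; congr (_, _); apply: val_inj => /=.
by apply: double_inj; apply/eqP; rewrite -(eqn_add2r b) e.
Qed.

Definition half_view kb : probability (view_space Q i) R :=
  view (cell_density R (half_index kb)).

Lemma sum_half_view S : measurable S ->
  (\sum_kb half_view kb S <= (2 ^+ J.+1)%:E * P0 S)%E.
Proof.
move=> mS; rewrite view_probE//.
rewrite (eq_bigr (fun kb => (\int[mu]_(x in I01 R)
   (fine (privatize Q i x S) * cell_density R (half_index kb) x))%:E)); last first.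
  by move=> kb _; rewrite -view_probE.
rewrite sumEFin -EFinM lee_fin.
have Iq (m : nat) : mu.-integrable (I01 R)
   (EFin \o (fun x => fine (privatize Q i x S) * (2 ^+ J.+1 * \1_(dyadic R J.+1 m) x))).
  apply: (@integrable_view _ _ _ _ _ _ (2 ^+ J.+1)) => //.
    apply: measurable_funM => //; apply: measurable_indic; exact: measurable_dyadic.
  move=> x; rewrite normrM ger0_norm// -[leRHS]mulr1 ler_wpM2l//.
  by rewrite indicE; case: (_ \in _); rewrite ?normr0 ?normr1.
have I1 : mu.-integrable (I01 R)
   (EFin \o (fun x => fine (privatize Q i x S) * \1_(I01 R) x)).
  apply: (@integrable_view _ _ _ _ _ _ 1) => //.
  by move=> x; rewrite indicE; case: (_ \in _); rewrite ?normr0 ?normr1.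
rewrite -RintegralZl//.
rewrite -Rintegral_sum01; last by move=> kb; exact: Iq.
apply: le_Rintegral => //.
- by apply: integrable_sum01 => kb; exact: Iq.
- exact: integrableZ01.
move=> x x01.
have -> : uniform_density R x = 1 by rewrite /= indicE mem_set.
rewrite mulr1 -mulr_sumr mulrC ler_wpM2r ?fine_ge0//.
rewrite -[leRHS]mulr1 -mulr_sumr ler_wpM2l//.
exact: (@sum_indic_dyadic_le1 R J.+1 _ _ x half_index_inj).
Qed.

(** A wavelet is a multiple of the difference of the uniform densities on the
    two halves of its support, so the law of a view under an alternative is an
    affine combination of the laws [half_view]. *)
Lemma view_alternative (c : 'I_(2 ^ J) -> R)
    (cB : forall k, `|c k| * 2 `^ (J%:R / 2) <= 1) S : measurable S ->
  fine (view (alternative cB) S) = fine (P0 S) +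
    \sum_k c k * (2 `^ (J%:R / 2) / 2 ^+ J.+1 *
      (fine (half_view (k, false) S) - fine (half_view (k, true) S))).
Proof.
move=> mS; rewrite /half_view !view_probE//=.
under [in RHS]eq_bigr do rewrite !view_probE//=.
set q := fun x : R => fine (privatize Q i x S).
have Iq (g : R -> R) (K : R) : measurable_fun setT g -> (forall x, `|g x| <= K) ->
    mu.-integrable (I01 R) (EFin \o (fun x => q x * g x)).
  by move=> mg gK; exact: integrable_view gK.
have I1 : mu.-integrable (I01 R) (EFin \o (fun x => q x * \1_(I01 R) x)).
  apply: (Iq _ 1); first by apply: measurable_indic; exact: measurable_itv.
  by move=> x; rewrite indicE; case: (_ \in _); rewrite ?normr0 ?normr1.
have Ic (m : nat) : mu.-integrable (I01 R)
    (EFin \o (fun x => q x * (2 ^+ J.+1 * \1_(dyadic R J.+1 m) x))).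
  apply: (Iq _ (2 ^+ J.+1)).
    apply: measurable_funM => //; apply: measurable_indic; exact: measurable_dyadic.
  move=> x; rewrite normrM ger0_norm// -[leRHS]mulr1 ler_wpM2l//.
  by rewrite indicE; case: (_ \in _); rewrite ?normr0 ?normr1.
have Iw (k : 'I_(2 ^ J)) : mu.-integrable (I01 R)
    (EFin \o (fun x => q x * wavelet J k x)).
  by apply: Iq; [exact: measurable_wavelet|exact: wavelet_norm].
have wE (k : 'I_(2 ^ J)) : \int[mu]_(x in I01 R) (q x * wavelet J k x) =
    2 `^ (J%:R / 2) / 2 ^+ J.+1 *
    (\int[mu]_(x in I01 R) (q x * (2 ^+ J.+1 * \1_(dyadic R J.+1 (k.*2 + false)) x)) -
     \int[mu]_(x in I01 R) (q x * (2 ^+ J.+1 * \1_(dyadic R J.+1 (k.*2 + true)) x))).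
  rewrite -RintegralB//.
  rewrite -RintegralZl//; last first.
    by have := integrableB _ (Ic (k.*2 + false)%N) (Ic (k.*2 + true)%N); apply.
  apply: eq_Rintegral => x _; rewrite waveletE addn0 addn1.
  by field; exact: expf_neq0.
under [in RHS]eq_bigr do rewrite -wE -RintegralZl//.
rewrite -Rintegral_sum01; last by move=> k; exact: integrableZ01.
rewrite -RintegralD//; last by apply: integrable_sum01 => k; exact: integrableZ01.
apply: eq_Rintegral => x _; rewrite mulrDr; congr (_ + _).
by rewrite /haar_series mulr_sumr; apply: eq_bigr => k _; rewrite mulrCA.
Qed.

(** The score phi k is a multiple of the difference of the densities of
    [half_view (k, false)] and [half_view (k, true)] with respect to the law of
    the view under the uniform density.  Privacy keeps these densities between
    exp (- alpha) and exp alpha, whence the pointwise bound; the last bound is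
    the contraction property of conditional expectation, obtained from the
    Jensen inequality for the weights given by the densities. *)
Lemma scores_exist : exists phi : 'I_(2 ^ J) -> view_space Q i -> R,
  [/\ forall k, measurable_fun setT (phi k),
      forall c, (forall k, `|c k| * 2 `^ (J%:R / 2) <= 1) ->
        forall z, 0 <= 1 + \sum_k c k * phi k z,
      forall c (cB : forall k, `|c k| * 2 `^ (J%:R / 2) <= 1) S, measurable S ->
        view (alternative cB) S =
        (\int[P0]_(z in S) (1 + \sum_k c k * phi k z)%:E)%E &
      forall k z, phi k z ^+ 2 <= (expR alpha - expR (- alpha)) ^+ 2 / 2 ^+ J.+2]
  /\ (forall k, (\int[P0]_z (phi k z)%:E = 0)%E)
  /\ (forall c, (\int[P0]_z ((\sum_k c k * phi k z) ^+ 2)%:E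
                  <= (\sum_k c k ^+ 2)%:E)%E).
Proof.
have finP (f : density R) S : measurable S -> view f S = (fine (view f S))%:E.
  by move=> mS; rewrite fineK//; exact: (fin_num_measure (@view_prob R n Q f i)).
have [p [mp pb psum pE]] : exists p : 'I_(2 ^ J) * bool -> view_space Q i -> R,
    [/\ forall kb, measurable_fun setT (p kb),
    forall kb z, expR (- alpha) <= p kb z <= expR alpha,
    forall z, \sum_kb p kb z <= 2 ^+ J.+1 &
    forall kb S, measurable S -> half_view kb S = (\int[P0]_(z in S) (p kb z)%:E)%E].
  apply: common_density => //.
  - move=> kb S mS; have := view_prob_le (uniform_density R)
      (cell_density R (half_index kb)) priv mS.
    change ((view (uniform_density R) S
        <= (expR alpha)%:E * view (cell_density R (half_index kb)) S)%E ->
      ((expR (- alpha))%:E * view (uniform_density R) S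
        <= view (cell_density R (half_index kb)) S)%E).
    rewrite (finP (uniform_density R))//.
    rewrite (finP (cell_density R (half_index kb)))// -!EFinM !lee_fin.
    move=> h; rewrite expRN mulrC ler_pdivrMr ?expR_gt0// mulrC; exact: h.
  - by move=> kb S mS; exact: view_prob_le.
  - exact: sum_half_view.
(* h is the height of a wavelet of level J, 2^(J+1) that of the uniform density
   on one of its halves. *)
pose h : R := 2 `^ (J%:R / 2); pose w : R := h / 2 ^+ J.+1.
have h0 : 0 < h by rewrite powR_gt0.
have w0 : 0 < w by rewrite divr_gt0// exprn_gt0.
have hh : h ^+ 2 = 2 ^+ J by exact: sqr_pow_half.
have p0 kb z : 0 <= p kb z.
  by have /andP[+ _] := pb kb z; apply: le_trans; exact: expR_ge0.
have psum2 z : \sum_k (p (k, false) z + p (k, true) z) <= 2 ^+ J.+1.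
  rewrite (le_trans _ (psum z))// [leRHS](_ : _ = \sum_k \sum_b p (k, b) z).
    by apply: ler_sum => k _; rewrite big_bool/= addrC.
  by rewrite pair_bigA /=; apply: eq_bigr => -[].
pose phi k z := w * (p (k, false) z - p (k, true) z).
have mphi k : measurable_fun setT (phi k).
  by apply: measurable_funM => //; exact: measurable_funB.
have Ip kb : P0.-integrable setT (EFin \o p kb).
  apply: (@bounded_integrable _ _ _ P0 _ (expR alpha)) => // z.
  by rewrite ger0_norm//; have /andP[_] := pb kb z.
have IphiS k S : measurable S -> P0.-integrable S (EFin \o phi k).
  move=> mS; apply: integrable_scale => //.
  have IpS kb : P0.-integrable S (EFin \o p kb) by exact: integrableS (Ip kb).
  by have := integrableB mS (IpS (k, false)) (IpS (k, true)); apply.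
have IcS (c : 'I_(2 ^ J) -> R) S : measurable S ->
    P0.-integrable S (EFin \o (fun z => \sum_k c k * phi k z)).
  move=> mS; apply: integrable_fsum => // k.
  by apply: integrable_scale => //; exact: IphiS.
have I1 S : measurable S -> P0.-integrable S (EFin \o cst 1).
  by move=> mS; exact: finite_measure_integrable_cst.
have phiE k S : measurable S -> \int[P0]_(z in S) phi k z =
    w * (\int[P0]_(z in S) p (k, false) z - \int[P0]_(z in S) p (k, true) z).
  move=> mS.
  have IpS kb : P0.-integrable S (EFin \o p kb) by exact: integrableS (Ip kb).
  rewrite RintegralZl//; last first.
    by have := integrableB mS (IpS (k, false)) (IpS (k, true)); apply.
  by rewrite RintegralB.
have p1 kb : \int[P0]_z p kb z = 1.
  by rewrite /Rintegral -pE// probability_setT.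
exists phi; split; [split => //|split].
- move=> c cB z.
  have : - (2 ^+ J.+1)^-1 * \sum_k (p (k, false) z + p (k, true) z)
      <= \sum_k c k * phi k z.
    rewrite mulr_sumr; apply: ler_sum => k _.
    have ck : `|c k * w| <= (2 ^+ J.+1)^-1.
      rewrite /w normrM [X in _ * X]ger0_norm ?divr_ge0 ?(ltW h0)// mulrA.
      by rewrite ler_pdivrMr ?exprn_gt0// mulVf ?expf_neq0// cB.
    rewrite /phi mulrA; move: ck; set a := c k * w; rewrite ler_norml => /andP[a1 a2].
    have := p0 (k, false) z; have := p0 (k, true) z.
    move: (p (k, false) z) (p (k, true) z) (2 ^+ J.+1)^-1 a1 a2 => x y v a1 a2 y0 x0.
    nra.
  move=> hsum; have : (2 ^+ J.+1)^-1 * \sum_k (p (k, false) z + p (k, true) z) <= 1.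
    by rewrite mulrC ler_pdivrMr ?exprn_gt0// mul1r.
  by move: hsum; rewrite mulNr; lra.
- move=> c cB S mS.
  have fE kb : fine (half_view kb S) = \int[P0]_(z in S) p kb z by rewrite pE.
  have -> : (\int[P0]_(z in S) (1 + \sum_k c k * phi k z)%:E)%E =
      (\int[P0]_(z in S) (1 + \sum_k c k * phi k z))%:E.
    rewrite fineK//; apply: (integrable_fin_num mS).
    by have := integrableD mS (I1 S mS) (IcS c S mS); apply.
  rewrite finP//; congr EFin; rewrite view_alternative//.
  rewrite RintegralD//; [|exact: I1|exact: IcS].
  rewrite Rintegral_cst// mul1r; congr (_ + _).
  rewrite Rintegral_fsum//; last by move=> k; apply: integrable_scale => //; exact: IphiS.
  apply: eq_bigr => k _; rewrite RintegralZl//; last exact: IphiS.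
  congr (_ * _); apply: etrans (esym (phiE k S mS)).
  by congr (w * (_ - _)); exact: fE.
- move=> k z; rewrite /phi exprMn.
  have -> : w ^+ 2 = (2 ^+ J.+2)^-1.
    rewrite /w exprMn hh !exprS; field; exact: expf_neq0.
  rewrite mulrC ler_pM2r ?invr_gt0 ?exprn_gt0//.
  have /andP[a1 a2] := pb (k, false) z; have /andP[b1 b2] := pb (k, true) z.
  nra.
- move=> k.
  rewrite -[LHS]fineK; last first.
    exact: (integrable_fin_num measurableT (IphiS k _ measurableT)).
  congr EFin; rewrite -[LHS]/(\int[P0]_z phi k z) phiE// !p1 subrr mulr0//.
- move=> c.
  pose A z := \sum_k 2^-1 * c k ^+ 2 * (p (k, false) z + p (k, true) z).
  have Ixy k : P0.-integrable setT (EFin \o (fun z => p (k, false) z + p (k, true) z)).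
    by have := integrableD measurableT (Ip (k, false)) (Ip (k, true)); apply.
  have IA : P0.-integrable setT (EFin \o A).
    by apply: integrable_fsum => // k; exact: integrable_scale.
  have -> : (\sum_k c k ^+ 2)%:E = (\int[P0]_z (A z)%:E)%E.
    rewrite -[RHS]fineK; last exact: (integrable_fin_num measurableT IA).
    congr EFin; rewrite -[RHS]/(\int[P0]_z A z) /A Rintegral_fsum//; last first.
      by move=> k; exact: integrable_scale.
    apply: eq_bigr => k _; rewrite RintegralZl// RintegralD// !p1.
    by field.
  apply: ge0_le_integral => //.
  - by move=> z _; rewrite lee_fin sqr_ge0.
  - apply/measurable_EFinP; apply: measurable_funX; apply: measurable_sum => k.
    exact: measurable_funM.
  - exact: measurable_int IA.
  move=> z _; rewrite lee_fin; set t := \sum_k _.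
  pose v : R := (2 ^+ J.+1)^-1.
  have v0 : 0 < v by rewrite invr_gt0 exprn_gt0.
  have vh : v * h ^+ 2 = 2^-1.
    by rewrite /v hh exprS; field; exact: expf_neq0.
  (* The p kb z / 2^(J+1) are weights of total mass at most 1, and t is the
     weighted sum of the values h c_k on left halves and - h c_k on right ones. *)
  have : 0 <= \sum_k v * (p (k, false) z * (h * c k - t) ^+ 2
                        + p (k, true) z * (h * c k + t) ^+ 2).
    by apply: sumr_ge0 => k _; rewrite mulr_ge0 ?(ltW v0)// addr_ge0// mulr_ge0// sqr_ge0.
  have -> : \sum_k v * (p (k, false) z * (h * c k - t) ^+ 2
                        + p (k, true) z * (h * c k + t) ^+ 2) =
     A z - 2 * t * \sum_k v * h * c k * (p (k, false) z - p (k, true) z)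
       + t ^+ 2 * (v * \sum_k (p (k, false) z + p (k, true) z)).
    move: (t) => a; rewrite /A !mulr_sumr -sumrB -big_split/=.
    by apply: eq_bigr => k _; rewrite -vh; ring.
  have -> : \sum_k v * h * c k * (p (k, false) z - p (k, true) z) = t.
    by apply: eq_bigr => k _; rewrite /phi /w -/v; ring.
  have : v * \sum_k (p (k, false) z + p (k, true) z) <= 1.
    by rewrite mulrC /v ler_pdivrMr ?exprn_gt0// mul1r.
  move: (v * \sum_k _) => u u1; have := sqr_ge0 t; nra.
Qed.

End channel_scores.

(** * Priors on the signs of the perturbation *)

Section prior.
Variables (R : realType) (n : nat) (Q : channel R n) (alpha : R).
Hypothesis priv : private alpha Q.
Variable J : nat.
Local Notation N := (2 ^ J)%N.
Local Notation P0 i := (@view_prob R n Q (uniform_density R) i).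

(** The matrix A i is the Gram matrix of the scores of the i-th view; it gives
    the second moment of a pair of likelihood ratios because the scores are
    centered. *)
Lemma interaction_matrix : exists (phi : forall i, 'I_N -> view_space Q i -> R)
    (A : 'I_n -> 'M[R]_N),
  [/\ forall i, [/\ forall k, measurable_fun setT (phi i k),
        forall c, (forall k, `|c k| * 2 `^ (J%:R / 2) <= 1) ->
          forall z, 0 <= 1 + \sum_k c k * phi i k z &
        forall c (cB : forall k, `|c k| * 2 `^ (J%:R / 2) <= 1) S,
          measurable S -> @view_prob R n Q (alternative cB) i S =
          (\int[P0 i]_(z in S) (1 + \sum_k c k * phi i k z)%:E)%E],
      forall i (x y : 'cV[R]_N),
        (\int[P0 i]_z ((1 + \sum_k x k 0 * phi i k z) *
                       (1 + \sum_k y k 0 * phi i k z))%:E =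
          (1 + (x^T *m A i *m y) 0 0)%:E)%E,
      forall i, (A i)^T = A i,
      forall i x, 0 <= qform (A i) x <= sqnorm x &
      forall i k, A i k k <= (expR alpha - expR (- alpha)) ^+ 2 / 2 ^+ J.+2].
Proof.
pose phi i := sval (cid (scores_exist i priv J)).
have phiP i := svalP (cid (scores_exist i priv J)); rewrite -/(phi _) in phiP.
exists phi, (fun i => \matrix_(k, l) \int[P0 i]_z (phi i k z * phi i l z)).
have mphi i k : measurable_fun setT (phi i k) by have [[h _ _ _] _] := phiP i; exact: h.
pose B : R := 1 + (expR alpha - expR (- alpha)) ^+ 2 / 2 ^+ J.+2.
have phiB i k z : `|phi i k z| <= B.
  have [[_ _ _ sqb] _] := phiP i.
  have bnd (a b : R) : 0 <= a -> a ^+ 2 <= b -> a <= 1 + b by nra.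
  by apply: bnd => //; rewrite real_normK ?num_real//; exact: sqb.
have Iphi i k : (P0 i).-integrable setT (EFin \o phi i k).
  exact: (@bounded_integrable _ _ _ (P0 i) _ B).
have Ipp i k l : (P0 i).-integrable setT (EFin \o (fun z => phi i k z * phi i l z)).
  apply: (@bounded_integrable _ _ _ (P0 i) _ (B * B)).
    exact: measurable_funM.
  by move=> z; rewrite normrM ler_pM.
have mean1 i : \int[P0 i]_z (1 : R) = 1.
  by rewrite Rintegral_cst// mul1r; exact: (congr1 fine (@probability_setT _ _ _ (P0 i))).
have mean0 i k : \int[P0 i]_z phi i k z = 0.
  by have [_ [m0 _]] := phiP i; rewrite /Rintegral m0.
have Isum i (x : 'I_N -> R) : (P0 i).-integrable setT
    (EFin \o (fun z => \sum_k x k * phi i k z)).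
  by apply: integrable_fsum => // k; exact: integrable_scale.
have Isum2 i (x y : 'I_N -> R) : (P0 i).-integrable setT
    (EFin \o (fun z => \sum_k \sum_l (x k * (y l * (phi i k z * phi i l z))))).
  apply: integrable_fsum => // k; apply: integrable_fsum => // l.
  by apply: integrable_scale => //; exact: integrable_scale.
have sumM i (x y : 'I_N -> R) z :
    (\sum_k x k * phi i k z) * (\sum_k y k * phi i k z) =
    \sum_k \sum_l (x k * (y l * (phi i k z * phi i l z))).
  rewrite mulr_suml; apply: eq_bigr => k _; rewrite mulr_sumr.
  by apply: eq_bigr => l _; ring.
have prodE i (x y : 'cV[R]_N) :
    \int[P0 i]_z ((\sum_k x k 0 * phi i k z) * (\sum_k y k 0 * phi i k z)) =
    (x^T *m (\matrix_(k, l) \int[P0 i]_z (phi i k z * phi i l z)) *m y) 0 0.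
  under eq_Rintegral do rewrite sumM.
  rewrite Rintegral_fsum//; last first.
    move=> k; apply: integrable_fsum => // l.
    by apply: integrable_scale => //; exact: integrable_scale.
  rewrite -mulmxA !mxE; apply: eq_bigr => k _; rewrite mxE mxE mulr_sumr.
  rewrite Rintegral_fsum//; last first.
    by move=> l; apply: integrable_scale => //; exact: integrable_scale.
  apply: eq_bigr => l _; rewrite mxE RintegralZl//; last exact: integrable_scale.
  by rewrite RintegralZl//; ring.
split.
- by move=> i; have [[h1 h2 h3 _] _] := phiP i; split.
- move=> i x y.
  pose f z := \sum_k x k 0 * phi i k z; pose g z := \sum_k y k 0 * phi i k z.
  have Ifg : (P0 i).-integrable setT (EFin \o (fun z => f z * g z)).
    by apply: eq_integrable (Isum2 i (x ^~ 0) (y ^~ 0)) => // z _ /=; rewrite -sumM.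
  have If : (P0 i).-integrable setT (EFin \o f) by exact: Isum.
  have Ig : (P0 i).-integrable setT (EFin \o g) by exact: Isum.
  have I1 : (P0 i).-integrable setT (EFin \o cst 1).
    exact: finite_measure_integrable_cst.
  have sum0 (w : 'I_N -> R) : \int[P0 i]_z (\sum_k w k * phi i k z) = 0.
    rewrite Rintegral_fsum// => [|k]; last exact: integrable_scale.
    by apply: big1 => k _; rewrite RintegralZl// mean0 mulr0.
  have I1f : (P0 i).-integrable setT (EFin \o (fun z => 1 + f z)).
    by have := integrableD measurableT I1 If; apply.
  have Igfg : (P0 i).-integrable setT (EFin \o (fun z => g z + f z * g z)).
    by have := integrableD measurableT Ig Ifg; apply.
  have Itot : (P0 i).-integrable setT
      (EFin \o (fun z => (1 + f z) + (g z + f z * g z))).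
    by have := integrableD measurableT I1f Igfg; apply.
  transitivity (\int[P0 i]_z ((1 + f z) + (g z + f z * g z)))%:E.
    rewrite fineK; last exact: (integrable_fin_num measurableT Itot).
    by apply: eq_integral => z _; congr EFin; rewrite /f /g; ring.
  congr EFin; rewrite !RintegralD// prodE !sum0 add0r addr0.
  have -> : \int[P0 i]_z (1 : R) = 1 by exact: mean1.
  by [].
- move=> i; apply/matrixP => k l; rewrite !mxE; apply: eq_Rintegral => z _.
  by rewrite mulrC.
- move=> i x; rewrite /qform -prodE; apply/andP; split.
    by apply: Rintegral_ge0 => z _; rewrite -expr2 sqr_ge0.
  have [_ [_ /(_ (x ^~ 0))]] := phiP i; rewrite -lee_fin; apply: le_trans.
  rewrite fineK; last first.
    apply: (integrable_fin_num measurableT).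
    by apply: eq_integrable (Isum2 i (x ^~ 0) (x ^~ 0)) => // z _ /=; rewrite -sumM.
  by rewrite le_eqVlt; apply/orP; left; apply/eqP/eq_integral.
- move=> i k; rewrite mxE.
  have [[_ _ _ sqb] _] := phiP i.
  apply: (@le_trans _ _ (\int[P0 i]_z ((expR alpha - expR (- alpha)) ^+ 2 / 2 ^+ J.+2))).
    apply: le_Rintegral => //; first exact: finite_measure_integrable_cst.
    by move=> z _; rewrite -expr2; exact: sqb.
  have := mean1 i; rewrite !Rintegral_cst// mul1r => ->.
  by rewrite mulr1.
Qed.

(** Here A is the sum of the Gram matrices over the views.  The set G collects
    the signs for which the perturbed function is a density: on G the factors
    1 + c A_i c'^T are integrals of nonnegative functions, so each may be bounded
    by its exponential, after which the sum extends to all pairs of signs. *)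
Lemma prior_error : exists A : 'M[R]_N,
  [/\ A^T = A, forall x, 0 <= qform A x <= n%:R * sqnorm x,
      forall k, A k k <= n%:R * ((expR alpha - expR (- alpha)) ^+ 2 / 2 ^+ J.+2) &
      forall m (W : 'M[R]_(m, N)) (delta kappa : R)
        (G : pred {ffun 'I_m -> bool}) (gamma beta eta X : R)
        (Delta : views (view_space Q) -> bool),
      let c nu k := delta * (signs R nu *m W) 0 k in
      0 < kappa -> (forall x, qform (W *m A *m W^T) x <= kappa * sqnorm x) ->
      (forall nu, G nu -> forall k, `|c nu k| * 2 `^ (J%:R / 2) <= 1) ->
      (0 < #|G|)%N ->
      (2 ^+ m) ^+ 2 * expR (2 * (delta ^+ 2) ^+ 2 * kappa ^+ 2 * m%:R)
        <= (1 + X) * #|G|%:R ^+ 2 ->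
      level_test gamma (uniform_density R) Delta ->
      0 < eta -> beta + ((1 + eta / 2) * gamma + X / (2 * eta)) < 1 ->
      exists nu (cB : forall k, `|c nu k| * 2 `^ (J%:R / 2) <= 1),
        (beta%:E < view_law Q (alternative cB) [set z | Delta z = false])%E].
Proof.
have [phi [A [phiP phiE symA quadA diagA]]] := interaction_matrix.
have qformS x : qform (\sum_i A i) x = \sum_i qform (A i) x.
  by rewrite /qform mulmx_sumr mulmx_suml summxE.
exists (\sum_i A i); split.
- by rewrite linear_sum; apply: eq_bigr => i _; exact: symA.
- move=> x; rewrite qformS; apply/andP; split.
    by apply: sumr_ge0 => i _; have /andP[] := quadA i x.
  apply: (@le_trans _ _ (\sum_(i < n) sqnorm x)).
    by apply: ler_sum => i _; have /andP[] := quadA i x.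
  by rewrite sumr_const card_ord mulr_natl.
- move=> k; rewrite summxE.
  apply: (@le_trans _ _ (\sum_(i < n) ((expR alpha - expR (- alpha)) ^+ 2 / 2 ^+ J.+2))).
    by apply: ler_sum => i _; exact: diagA.
  by rewrite sumr_const card_ord mulr_natl.
move=> m W delta kappa G gamma beta eta X Delta c k0 WAW cG G0 hX [mDelta lev] eta0 lt1.
(* Otherwise every sign in G gives a missed probability at most beta, against
   the conclusion of the mixture bound. *)
have [//|none] := pselect (exists nu (cB : forall k, `|c nu k| * 2 `^ (J%:R / 2) <= 1),
        (beta%:E < view_law Q (alternative cB) [set z | Delta z = false])%E).
(* Outside G the perturbed function may fail to be a density; the mixture is
   over G only, so the uniform density can stand in there. *)
pose P nu : density R := if pselect (forall k, `|c nu k| * 2 `^ (J%:R / 2) <= 1)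
  is left cB then alternative cB else uniform_density R.
pose r nu i z := 1 + \sum_k c nu k * phi i k z.
pose q nu nu' i := 1 + (\row_k c nu k *m A i *m (\row_k c nu' k)^T) 0 0.
have PE nu (cB : forall k, `|c nu k| * 2 `^ (J%:R / 2) <= 1) : P nu = alternative cB.
  by rewrite /P; case: pselect => // cB'; congr alternative; exact: Prop_irrelevance.
have mr nu i : measurable_fun setT (r nu i).
  apply: measurable_funD => //; apply: measurable_sum => k.
  by apply: measurable_funM => //; have [h _ _] := phiP i; exact: h.
have r0 nu : G nu -> forall i z, 0 <= r nu i z.
  by move=> Gnu i z; have [_ h _] := phiP i; apply: h; exact: cG.
have rP nu : G nu -> forall i S, measurable S -> @view_prob R n Q (P nu) i S =
    (\int[P0 i]_(z in S) (r nu i z)%:E)%E.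
  move=> Gnu i S mS; rewrite (PE nu (cG nu Gnu)).
  by have [_ _ h] := phiP i; exact: h.
have qE nu nu' : G nu -> G nu' -> forall i,
    (\int[P0 i]_z (r nu i z * r nu' i z)%:E = (q nu nu' i)%:E)%E.
  move=> _ _ i; have := phiE i (\row_k c nu k)^T (\row_k c nu' k)^T.
  rewrite trmxK => <-; apply: eq_integral => z _; congr EFin.
  by congr ((_ + _) * (_ + _)); apply: eq_bigr => k _; rewrite !mxE.
have q0 nu nu' i : G nu -> G nu' -> 0 <= q nu nu' i.
  move=> Gnu Gnu'; rewrite -lee_fin -qE//; apply: integral_ge0 => z _.
  by rewrite lee_fin mulr_ge0// r0.
pose C := W *m (\sum_i A i) *m W^T.
have symC : C^T = C.
  rewrite /C !trmx_mul trmxK mulmxA linear_sum; congr (_ *m _ *m _).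
  by apply: eq_bigr => i _; exact: symA.
have qC x : qform C x = qform (\sum_i A i) (W^T *m x).
  by rewrite /qform /C trmx_mul trmxK !mulmxA.
have C0 x : 0 <= qform C x.
  rewrite qC qformS; apply: sumr_ge0 => i _.
  by have /andP[] := quadA i (W^T *m x).
have Cn := sqnorm_mulmx_le k0 symC C0 WAW.
have sumq : \sum_(nu | G nu) \sum_(nu' | G nu') \prod_i q nu nu' i <=
    (1 + X) * #|G|%:R ^+ 2.
  apply: le_trans hX; apply: le_trans (sum_expR_chaos (delta ^+ 2) Cn).
  have prod_le nu nu' : G nu -> G nu' -> \prod_i q nu nu' i <=
      expR (delta ^+ 2 * (signs R nu *m C *m (signs R nu')^T) 0 0).
    move=> Gnu Gnu'.
    have -> : delta ^+ 2 * (signs R nu *m C *m (signs R nu')^T) 0 0 =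
        \sum_i (q nu nu' i - 1).
      rewrite /C !mulmxA !(mulmx_sumr, mulmx_suml) summxE mulr_sumr.
      apply: eq_bigr => i _; rewrite /q addrC addKr.
      have rowE (mu : {ffun 'I_m -> bool}) : \row_k c mu k = delta *: (signs R mu *m W).
        by apply/rowP => k; rewrite [LHS]mxE [RHS]mxE.
      rewrite !rowE linearZ/= trmx_mul -!scalemxAl -scalemxAr scalerA -expr2.
      by rewrite [RHS]mxE !mulmxA.
    rewrite expR_sum; apply: ler_prod => i _; rewrite q0//=.
    by have := expR_ge1Dx (q nu nu' i - 1); rewrite addrC subrK.
  rewrite [leRHS](bigID G)/= -[leLHS]addr0 lerD//; last first.
    by apply: sumr_ge0 => nu _; apply: sumr_ge0 => nu' _; exact: expR_ge0.
  apply: ler_sum => nu Gnu; rewrite [leRHS](bigID G)/= -[leLHS]addr0 lerD//.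
    by apply: ler_sum => nu' Gnu'; exact: prod_le.
  by apply: sumr_ge0 => nu' _; exact: expR_ge0.
pose D : set (views (view_space Q)) := [set z | Delta z = true].
have mD : measurable D.
  by have := mDelta measurableT [set true]; rewrite setTI; apply.
have := mixture_error mr r0 rP qE G0 sumq mD lev eta0 (beta := beta).
suff h : forall nu, G nu -> (prod_prob (fun i =>
    @view_prob R n Q (P nu) i : probability (view_space Q i) R) (~` D) <= beta%:E)%E.
  by move=> /(_ h); lra.
move=> nu Gnu; rewrite leNgt; apply/negP => lt.
apply: none; exists nu, (cG nu Gnu); rewrite -PE /view_law.
rewrite (_ : [set z | _] = ~` D)//.
by apply/seteqP; split => z /=; rewrite /D /=; case: (Delta z).
Qed.

End prior.

(** * Missed alternatives at a fixed resolution *)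

Section separation.
Variables (R : realType) (n : nat).
Local Notation f0 := (uniform_density R).

Lemma rho_star_ge (C : set (R -> R)) (alpha gamma beta r : R) :
  (forall Q : channel R n, private alpha Q ->
    forall Delta, level_test gamma f0 Delta ->
    exists f : density R, [/\ C f, (r%:E <= L2norm (f \- f0)%R)%E &
      (beta%:E < view_law Q f [set z | Delta z = false])%E]) ->
  (r%:E <= rho_star n C alpha gamma beta f0)%E.
Proof.
move=> h; apply: le_ereal_inf_tmp => _ [Q privQ ->].
apply: le_ereal_inf_tmp => _ [Delta lev <-].
apply: le_ereal_inf_tmp => _ [rho [rho0 hsup] <-].
rewrite leNgt; apply/negP => rhor.
have [f [Cf fr fb]] := h Q privQ Delta lev.
move: fb; rewrite ltNge => /negP; apply.
apply: le_trans hsup; apply: ereal_sup_ubound; exists f => //.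
by split => //; exact: lt_le_trans fr.
Qed.

Lemma alternative_besov J (c : 'I_(2 ^ J) -> R)
    (cB : forall k, `|c k| * 2 `^ (J%:R / 2) <= 1) (s M : R) :
  \sum_k c k ^+ 2 <= M ^+ 2 * 2 `^ (- (2 * J%:R * s)) ->
  besov f0 s M (alternative cB).
Proof.
move=> cM; split.
  have [B B0 hB] := haar_series_bounded c.
  have [|x|//] := @L2norm_bounded R (alternative cB) (1 + B).
    apply: measurable_funD; last exact: measurable_haar_series.
    by apply: measurable_indic; exact: measurable_itv.
  rewrite (le_trans (ler_normD _ _))// lerD//.
  by rewrite indicE; case: (_ \in _); rewrite ?normr0 ?normr1.
rewrite alternative_subE; split; first by have [] := haar_series_L2 c.
move=> j; rewrite sum_sqr_haar_coef; case: eqVneq => [->//|_].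
by rewrite mulr_ge0 ?sqr_ge0// powR_ge0.
Qed.

End separation.

Section fixed_resolution.
Variables (R : realType) (n : nat) (Q : channel R n) (alpha : R).
Hypotheses (alpha0 : 0 < alpha) (n0 : (0 < n)%N) (priv : private alpha Q).
Variables (gamma beta : R) (Delta : views (view_space Q) -> bool).
Hypotheses (gamma1 : gamma < 1) (gb1 : gamma + beta < 1).
Hypothesis lev : level_test gamma (uniform_density R) Delta.
Variables (s M D : R) (J : nat).
Hypotheses (D0 : 0 < D) (DM : D <= M ^+ 2 * 2 `^ (- (2 * J%:R * s))).
Local Notation f0 := (uniform_density R).

(** Chosen so that (1 - 3 slack) (1 + sigma^2) = 1 with
    sigma = 1 - gamma - beta: a chi-square distance sigma^2 is tolerable, and it is
    shared between the exponent of the chaos and the proportion of bad signs. *)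
Definition slack : R :=
  (1 - gamma - beta) ^+ 2 / (3 * (1 + (1 - gamma - beta) ^+ 2)).

Let sigma := 1 - gamma - beta.

Let sigma0 : 0 < sigma.
Proof. by rewrite /sigma -addrA -opprD subr_gt0. Qed.

Lemma slackE : (1 - 3 * slack) * (1 + sigma ^+ 2) = 1.
Proof.
have h : 0 < 1 + sigma ^+ 2 by rewrite addr_gt0// exprn_gt0.
by rewrite /slack -/sigma; field; rewrite gt_eqF.
Qed.

Lemma slack_gt0 : 0 < slack.
Proof.
by rewrite divr_gt0 ?exprn_gt0// mulr_gt0// addr_gt0// exprn_gt0.
Qed.

Lemma slack_lt : slack < 3^-1.
Proof.
have := slackE; have := sqr_ge0 sigma; move: (slack) (sigma ^+ 2) => e S S0 h.
nra.
Qed.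

Lemma budget : beta + ((1 + sigma / 2) * gamma + sigma ^+ 2 / (2 * sigma)) < 1.
Proof.
have -> : sigma ^+ 2 / (2 * sigma) = sigma / 2 by field; rewrite gt_eqF.
by have h1 := gamma1; have h2 := gb1; rewrite /sigma; nra.
Qed.

(** Since exp E <= 1/(1 - slack), the left side is at most
    g^2 / (1 - slack)^3, and (1 - slack)^3 >= 1 - 3 slack. *)
Lemma chi_square_budget (E p g : R) : E <= slack -> 0 <= p ->
  (1 - slack) * p <= g -> p ^+ 2 * expR E <= (1 + sigma ^+ 2) * g ^+ 2.
Proof.
move=> Ee p0 pg; have e0 := slack_gt0; have e1 := slack_lt; have eE := slackE.
have expE : expR E <= (1 - slack)^-1.
  rewrite -[leLHS]invrK lef_pV2 ?posrE ?invr_gt0 ?expR_gt0//; last lra.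
  rewrite -expRN; apply: le_trans (expR_ge1Dx _); lra.
have g2 : ((1 - slack) * p) ^+ 2 <= g ^+ 2.
  rewrite lerXn2r ?nnegrE ?mulr_ge0//; first by lra.
  by apply: le_trans pg; rewrite mulr_ge0//; lra.
apply: (@le_trans _ _ (p ^+ 2 * (1 - slack)^-1)).
  by rewrite ler_wpM2l ?sqr_ge0.
apply: (@le_trans _ _ ((1 + sigma ^+ 2) * ((1 - slack) * p) ^+ 2)); last first.
  by rewrite ler_wpM2l// addr_ge0// sqr_ge0.
rewrite ler_pdivrMr; last lra.
rewrite exprMn; have := sqr_ge0 p; have := sqr_ge0 sigma.
move: (sigma ^+ 2) (p ^+ 2) eE => S P eE S0 P0.
have h : 1 <= (1 + S) * (1 - slack) ^+ 3.
  rewrite -[leLHS]eE mulrC ler_wpM2l//; first by lra.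
  by move: e0 e1; move: (slack) => e; nra.
move: h; move: (slack) => e h; nra.
Qed.

Let half : 2 `^ (J%:R / 2) = Num.sqrt (2 ^+ J) :> R.
Proof. by rewrite -(sqr_pow_half R J) sqrtr_sqr ger0_norm ?powR_ge0. Qed.

Let N0 : 0 < 2 ^+ J :> R. Proof. by rewrite exprn_gt0. Qed.

Let delta := Num.sqrt (D / 2 ^+ J).

Let delta2 : delta ^+ 2 = D / 2 ^+ J.
Proof. by rewrite sqr_sqrtr// divr_ge0// ltW. Qed.

Let delta_half : delta * 2 `^ (J%:R / 2) = Num.sqrt D.
Proof. by rewrite half -sqrtrM ?divr_ge0 ?ltW// divfK// gt_eqF. Qed.

(** With W the identity all the coefficients are +-delta, so D <= 1 makes every
    perturbed function a density. *)
Lemma full_prior_alternative : D <= 1 ->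
  2 * n%:R ^+ 2 * D ^+ 2 / 2 ^+ J <= slack ->
  exists f : density R, [/\ besov f0 s M f,
    ((Num.sqrt D)%:E <= L2norm (f \- f0)%R)%E &
    (beta%:E < view_law Q f [set z | Delta z = false])%E].
Proof.
move=> D1 small; have [A [symA quadA _ H]] := prior_error priv J.
have {}H := @H _ 1%:M delta n%:R xpredT gamma beta sigma (sigma ^+ 2) Delta.
have sumc (nu : {ffun 'I_(2 ^ J) -> bool}) :
    \sum_k (delta * (signs R nu *m 1%:M) 0 k) ^+ 2 = D.
  under eq_bigr do rewrite mulmx1 mxE exprMn sqrr_sign mulr1 delta2.
  by rewrite sumr_const card_ord -[LHS]mulr_natr natrX divfK// gt_eqF.
have [||||||||nu [cB hb]] := H => //.
- by rewrite ltr0n.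
- by move=> x; rewrite mul1mx trmx1 mulmx1; have /andP[] := quadA x.
- move=> nu _ k; rewrite mulmx1 mxE normrM normrX normrN1 expr1n mulr1.
  rewrite ger0_norm ?sqrtr_ge0// delta_half -[leRHS]sqrtr1 ler_wsqrtr//.
- by rewrite card_ffun card_bool card_ord expn_gt0.
- rewrite card_ffun card_bool card_ord natrX.
  apply: chi_square_budget => //.
  + apply: le_trans small; rewrite delta2 le_eqVlt; apply/orP; left; apply/eqP.
    by field; rewrite gt_eqF.
  + by rewrite natrX ler_piMl ?exprn_ge0//; have := slack_gt0; lra.
- exact: budget.
exists (alternative cB); split => //.
- by apply: alternative_besov; rewrite sumc.
- have [_ nE] := haar_series_L2 (fun k => delta * (signs R nu *m 1%:M) 0 k).
  by rewrite alternative_subE nE sumc.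
Qed.

(** The second hypothesis is the union bound: a coefficient is too large with
    probability at most 2 exp (- 1 / (8 D)).  The factor 1/2 in the separation
    comes from the dimension m >= N/2 of the frame. *)
Lemma low_energy_alternative :
  let z := expR (2 * alpha) - expR (- (2 * alpha)) in
  (n%:R * z ^+ 2 * D) ^+ 2 / (32 * (2 ^+ J) ^+ 3) <= slack ->
  2 * 2 ^+ J * expR (- (8 * D)^-1) <= slack ->
  exists f : density R, [/\ besov f0 s M f,
    ((Num.sqrt (D / 2))%:E <= L2norm (f \- f0)%R)%E &
    (beta%:E < view_law Q f [set z | Delta z = false])%E].
Proof.
move=> z small tail; have [A [symA quadA diagA H]] := prior_error priv J.
set u := expR alpha - expR (- alpha) in diagA.
have u0 : 0 < u by rewrite subr_gt0 ltr_expR; have a0 := alpha0; lra.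
have uz : 2 * u <= z.
  have e1 : expR (2 * alpha) = expR alpha ^+ 2.
    by rewrite -expRM_natl; congr expR; ring.
  have e2 : expR (- (2 * alpha)) = expR (- alpha) ^+ 2.
    by rewrite -expRM_natl; congr expR; ring.
  have ab : expR alpha * expR (- alpha) = 1 by rewrite -expRD subrr expR0.
  rewrite /z e1 e2; move: u0 ab; rewrite /u.
  have := expR_gt0 alpha; have := expR_gt0 (- alpha).
  move: (expR alpha) (expR (- alpha)) => a b b0 a0 ab0 ab.
  have ab2 : 2 <= a + b.
    rewrite -(@ler_pXn2r _ 2) ?nnegrE//; last by rewrite addr_ge0// ltW.
    by have := sqr_ge0 (a - b); nra.
  by rewrite subr_sqr mulrC ler_pM2l.
set tau := n%:R * (u ^+ 2 / 2 ^+ J.+2) in diagA.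
have tau0 : 0 < tau by rewrite mulr_gt0 ?ltr0n// divr_gt0 ?exprn_gt0.
have psdA x : 0 <= qform A x by have /andP[] := quadA x.
have [m [W [/andP[mN Nm] WW colW WAW]]] := low_energy_frame tau0 symA psdA diagA.
pose a nu k := (signs R nu *m W) 0 k.
pose G := [pred nu : {ffun 'I_m -> bool} |
  [forall k, `|delta * a nu k| * 2 `^ (J%:R / 2) <= 1]].
have mNR : m%:R <= 2 ^+ J :> R by rewrite -natrX ler_nat.
have NmR : 2 ^+ J <= 2 * m%:R :> R by rewrite -natrX -natrM ler_nat.
have sumc (nu : {ffun 'I_m -> bool}) :
    \sum_k (delta * a nu k) ^+ 2 = D / 2 ^+ J * m%:R.
  under eq_bigr do rewrite exprMn delta2.
  rewrite -mulr_sumr; congr (_ * _).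
  transitivity ((signs R nu *m W *m (signs R nu *m W)^T) 0 0).
    by rewrite mxE; apply: eq_bigr => k _; rewrite [_^T _ _]mxE expr2.
  rewrite trmx_mul -mulmxA (mulmxA W) WW mul1mx -(sqnorm_signs R nu) sqnormE.
  by rewrite trmxK.
(* As delta 2^(J/2) = sqrt D, a coefficient is admissible exactly when
   |a_k| <= 1 / sqrt D. *)
pose T k := [pred nu : {ffun 'I_m -> bool} |
  Num.sqrt D^-1 < `|(signs R nu *m col k W) 0 0|].
have cardT k : #|T k|%:R <= 2 * 2 ^+ m * expR (- (8 * D)^-1).
  have -> : (8 * D)^-1 = Num.sqrt D^-1 ^+ 2 / 8.
    by rewrite sqr_sqrtr ?invr_ge0 ?ltW// invfM mulrC.
  apply: signs_tail => //; apply: le_trans (colW k).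
  by rewrite le_eqVlt; apply/orP; left; apply/eqP/eq_bigr => l _; rewrite mxE.
have coverG : (#|[predC G]| <= \sum_k #|T k|)%N.
  rewrite -sum1_card (eq_bigr _ (fun k _ => esym (sum1_card (T k)))) big_mkcond/=.
  rewrite (eq_bigr (fun k => \sum_nu (nu \in T k : nat))%N); last first.
    by move=> k _; rewrite big_mkcond/=; apply: eq_bigr => nu _; case: (_ \in _).
  rewrite exchange_big/=; apply: leq_sum => nu _; case: ifPn => //.
  rewrite !inE negb_forall => /existsP[k]; rewrite -ltNge => big_k.
  rewrite (bigD1 k)//= (_ : (nu \in T k) = true)//.
  rewrite inE colE mulmxA -colE mxE -(ltr_pM2r (_ : 0 < Num.sqrt D)) ?sqrtr_gt0//.
  rewrite -sqrtrM ?invr_ge0 ?ltW// mulVf ?gt_eqF// sqrtr1.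
  apply: lt_le_trans big_k _; rewrite normrM ger0_norm ?sqrtr_ge0//.
  by rewrite -delta_half -mulrA mulrCA.
have cardG : (1 - slack) * 2 ^+ m <= #|G|%:R.
  have := cardC G; rewrite card_ffun card_bool card_ord => cG.
  have tot : #|G|%:R + #|[predC G]|%:R = 2 ^+ m :> R by rewrite -natrD cG natrX.
  have bad : #|[predC G]|%:R <= slack * 2 ^+ m :> R.
    move: coverG; rewrite -(ler_nat R) natr_sum => /le_trans; apply.
    apply: (@le_trans _ _ (\sum_(k < (2 ^ J)%N) (2 * 2 ^+ m * expR (- (8 * D)^-1)))).
      by apply: ler_sum => k _; exact: cardT.
    rewrite sumr_const card_ord -[leLHS]mulr_natl natrX.
    move: tail; rewrite -(ler_pM2r (_ : 0 < 2 ^+ m)) ?exprn_gt0//.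
    by apply: le_trans; rewrite le_eqVlt; apply/orP; left; apply/eqP; ring.
  by move: tot bad; rewrite mulrBl mul1r; lra.
have {}H := @H m W delta (2 * tau) G gamma beta sigma (sigma ^+ 2) Delta.
have [||||||||nu [cB hb]] := H => //.
- by rewrite mulr_gt0.
- by move=> nu; rewrite inE => /forallP.
- rewrite -(ltr0n R); apply: lt_le_trans cardG; rewrite mulr_gt0 ?exprn_gt0//.
  by have := slack_lt; lra.
- apply: chi_square_budget => //.
  apply: le_trans small; rewrite delta2 /tau.
  have -> : 2 * (D / 2 ^+ J) ^+ 2 * (2 * (n%:R * (u ^+ 2 / 2 ^+ J.+2))) ^+ 2 * m%:R
      = (n%:R * D) ^+ 2 * u ^+ 4 * (m%:R / (2 ^+ J) ^+ 4) / 2.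
    by rewrite !exprS; field; exact: expf_neq0.
  have -> : (n%:R * z ^+ 2 * D) ^+ 2 / (32 * (2 ^+ J) ^+ 3) =
      (n%:R * D) ^+ 2 * (z ^+ 4 / 16) * (2 ^+ J / (2 ^+ J) ^+ 4) / 2.
    by field; rewrite gt_eqF.
  rewrite ler_pM2r ?invr_gt0//; apply: ler_pM.
  - by rewrite mulr_ge0 ?sqr_ge0// exprn_ge0// ltW.
  - by rewrite divr_ge0// exprn_ge0// ltW.
  - rewrite ler_wpM2l ?sqr_ge0// ler_pdivlMr//.
    have -> : u ^+ 4 * 16 = (2 * u) ^+ 4 by ring.
    rewrite lerXn2r ?nnegrE//; first by rewrite mulr_ge0// ltW.
    by apply: le_trans uz; rewrite mulr_ge0// ltW.
  - by rewrite ler_pM2r// invr_gt0 exprn_gt0.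
- exact: budget.
exists (alternative cB); split => //.
- apply: alternative_besov; rewrite sumc; apply: le_trans DM.
  by rewrite mulrAC ler_pdivrMr// ler_pM2l.
- have [_ nE] := haar_series_L2 (fun k => delta * a nu k).
  rewrite alternative_subE nE sumc lee_fin ler_wsqrtr//.
  by rewrite mulrAC ler_pdivlMr// mulrAC ler_pdivrMr// -mulrA ler_pM2l// mulrC.
Qed.

End fixed_resolution.

(** * Separation rates *)

Section rates.
Variable R : realType.
Implicit Types (s t : R) (n J : nat).

Lemma powR_expR (a x : R) : 0 < a -> a `^ x = expR (x * ln a).
Proof. by move=> a0; rewrite /powR gt_eqF. Qed.

Lemma ln_ge_half n : (2 <= n)%N -> 2^-1 <= ln n%:R :> R.
Proof.
move=> n2; have : ln (1 + (- 2^-1)) <= - 2^-1 :> R by apply: le_ln1Dx; lra.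
have -> : 1 + - 2^-1 = 2^-1 :> R by lra.
rewrite lnV ?posrE// lerN2 => h; apply: (le_trans h).
by rewrite ler_ln ?posrE ?ltr0n ?ler_nat//; lia.
Qed.

(** J is the integer part of 2 t / log 2.  Rounding down is what makes the
    smoothness bound hold without a constant depending on s. *)
Lemma dyadic_resolution t : 0 <= t ->
  exists J, (2 ^+ J <= expR (2 * t) <= 2 * 2 ^+ J) /\
    forall s, 0 < s -> expR (- (4 * s * t)) <= 2 `^ (- (2 * J%:R * s)).
Proof.
move=> t0; have l0 : 0 < ln 2 :> R by rewrite ln_gt0// ltr1n.
exists (Num.truncn (2 * t / ln 2)); set J := Num.truncn _.
have powJ m : 2 ^+ m = expR (m%:R * ln 2) :> R.
  by rewrite expRM_natl lnK ?posrE.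
have J1 : J%:R * ln 2 <= 2 * t.
  rewrite -ler_pdivlMr//.
  by have /andP[] := truncn_itv (divr_ge0 (mulr_ge0 (ler0n R 2) t0) (ltW l0)).
have J2 : 2 * t <= J.+1%:R * ln 2.
  by rewrite -ler_pdivrMr// ltW// truncnS_gt.
split; first by rewrite -exprS !powJ !ler_expR J1 J2.
move=> s s0; rewrite powR_expR// ler_expR mulNr lerN2.
have -> : 2 * J%:R * s * ln 2 = 2 * s * (J%:R * ln 2) by ring.
have -> : 4 * s * t = 2 * s * (2 * t) by ring.
by rewrite ler_pM2l// mulr_gt0.
Qed.

(** The left side is 2 n^(-K) with K = 1/(16 C) - 2, and n^K >= 1 + K/2 since
    log n >= 1/2; moreover 32 C (1 + K/2) = 1. *)
Lemma polynomial_tail n (C e : R) : (2 <= n)%N -> 0 < C -> 64 * C <= e -> 64 * C <= 1 ->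
  2 * n%:R ^+ 2 * expR (- (ln n%:R / (16 * C))) <= e.
Proof.
move=> n2 C0 Ce C1; have l2 := ln_ge_half n2; set l := ln n%:R in l2 *.
have n0 : 0 < n%:R :> R by rewrite ltr0n; exact: ltnW n2.
have -> : n%:R ^+ 2 = expR (2 * l) :> R by rewrite expRM_natl lnK ?posrE.
rewrite -mulrA -expRD; apply: le_trans Ce.
have -> : 2 * l + - (l / (16 * C)) = - ((16 * C)^-1 - 2) * l by ring.
set K := (16 * C)^-1 - 2.
have KC : 32 * C * (1 + K / 2) = 1 by rewrite /K; field; rewrite gt_eqF.
have K0 : 0 <= K.
  by rewrite /K subr_ge0 -[leLHS]invrK lef_pV2 ?posrE ?invr_gt0 ?mulr_gt0//; lra.
have h : 1 + K / 2 <= expR (K * l).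
  by apply: le_trans (expR_ge1Dx _); nra.
rewrite mulNr expRN; have e0 := expR_gt0 (K * l).
rewrite ler_pdivrMr//; nra.
Qed.

Variables (gamma beta M : R).
Hypotheses (gamma1 : gamma < 1) (gb1 : gamma + beta < 1) (M0 : 0 < M).
Local Notation f0 := (uniform_density R).
Local Notation e := (slack gamma beta).

(** The square of the constant in the final bound.  The first term serves the
    Besov radius, the second one the chi-square and positivity constraints. *)
Definition rate_const : R := Num.min (M ^+ 2 / 4) (e / 64).
Let C := rate_const.

Lemma rate_const_gt0 : 0 < rate_const.
Proof.
by rewrite lt_min; apply/andP; split; rewrite divr_gt0 ?exprn_gt0//; exact: slack_gt0.
Qed.

Let C0 : 0 < C := rate_const_gt0.

Let CM : 4 * C <= M ^+ 2.
Proof. by rewrite mulrC -ler_pdivlMr// ge_min lexx. Qed.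

Let Ce : 64 * C <= e.
Proof. by rewrite mulrC -ler_pdivlMr// ge_min lexx orbT. Qed.

Let C1 : 64 * C <= 1.
Proof. by apply: (le_trans Ce); have := slack_lt gb1; lra. Qed.

(** The resolution balances D = 2 C r^2 against the chi-square constraint
    n D <= sqrt N: N is close to n^(2/(4s+1)), written exp (2t). *)
Lemma nonprivate_rate (alpha s : R) n : 0 < s -> (2 <= n)%N ->
  ((Num.sqrt C * n%:R `^ (- (2 * s) / (4 * s + 1)))%:E
    <= rho_star n (besov f0 s M) alpha gamma beta f0)%E.
Proof.
move=> s0 n2; have n0 : 0 < n%:R :> R by rewrite ltr0n; exact: ltnW n2.
have l2 := ln_ge_half n2.
pose t := ln n%:R / (4 * s + 1).
have d0 : 0 < 4 * s + 1 by lra.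
have t0 : 0 <= t by rewrite divr_ge0//; lra.
have [J [/andP[J1 J2] Js]] := dyadic_resolution t0.
set r := _ `^ _; have rE : r = expR (- (2 * s * t)).
  by rewrite /r powR_expR//; congr expR; rewrite /t; field; rewrite gt_eqF.
have nE : n%:R ^+ 2 = expR (2 * t) * expR (4 * (2 * s * t)) :> R.
  rewrite -[n%:R]lnK ?posrE// -expRM_natl -expRD; congr expR; rewrite /t; field.
  by rewrite gt_eqF.
have r4 : expR (4 * (2 * s * t)) * r ^+ 4 = 1.
  by rewrite rE -expRM_natl -expRD -[RHS]expR0; congr expR; ring.
have r0 : 0 < r by rewrite rE expR_gt0.
have r1 : r <= 1.
  by rewrite rE -expR0 ler_expR oppr_le0 mulr_ge0// mulr_ge0// ltW.
have r2 : r ^+ 2 <= 2 `^ (- (2 * J%:R * s)).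
  apply: le_trans (Js s s0); rewrite rE -expRM_natl ler_expR; lra.
pose D := 2 * C * r ^+ 2.
have D0 : 0 < D by rewrite !mulr_gt0// exprn_gt0.
apply: rho_star_ge => Q privQ Delta lev.
have DM : D <= M ^+ 2 * 2 `^ (- (2 * J%:R * s)).
  by rewrite /D ler_pM// ?ltW ?mulr_gt0 ?exprn_gt0//; have := CM; have := C0; lra.
have C2 := C1; have Cpos := C0; have Ceps := Ce.
have rr1 : r ^+ 2 <= 1 by rewrite exprn_ile1// ltW.
have D1 : D <= 1 by rewrite /D; nra.
have small : 2 * n%:R ^+ 2 * D ^+ 2 / 2 ^+ J <= e.
  rewrite ler_pdivrMr ?exprn_gt0//.
  have -> : 2 * n%:R ^+ 2 * D ^+ 2 =
      8 * C ^+ 2 * expR (2 * t) * (expR (4 * (2 * s * t)) * r ^+ 4).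
    by rewrite nE /D; ring.
  rewrite r4 mulr1; apply: (@le_trans _ _ (8 * C ^+ 2 * (2 * 2 ^+ J))).
    by rewrite ler_wpM2l// mulr_ge0// sqr_ge0.
  by rewrite mulrA ler_wpM2r ?exprn_ge0//; nra.
have g1 := gamma1.
have nn : (0 < n)%N := ltnW n2.
have [f [fB fn fb]] := full_prior_alternative nn privQ g1 gb1 lev D0 DM D1 small.
exists f; split => //; apply: le_trans fn; rewrite lee_fin.
have -> : Num.sqrt C * r = Num.sqrt (C * r ^+ 2).
  by rewrite sqrtrM ?(ltW C0)// sqrtr_sqr ger0_norm ?(ltW r0).
by rewrite ler_wsqrtr// /D ler_pM2r ?exprn_gt0//; lra.
Qed.

(** The resolution balances D = 2 C r^2 against the chi-square constraint
    n z^2 D <= N^(3/2): N is close to (n z^2)^(2/(4s+3)), written exp (2t), or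
    N = 1 when t < 0.  The assumed comparison of the two rates gives t <= log n,
    hence N <= n^2, as the union bound requires. *)
Lemma private_rate (alpha s : R) n :
  let z := expR (2 * alpha) - expR (- (2 * alpha)) in
  0 < alpha -> 0 < s -> (2 <= n)%N ->
  n%:R `^ (- (2 * s) / (4 * s + 1)) <
    (n%:R * z ^+ 2) `^ (- (2 * s) / (4 * s + 3)) ->
  ((Num.sqrt C * Num.min ((n%:R * z ^+ 2) `^ (- (2 * s) / (4 * s + 3)))
                         (ln n%:R `^ (- 2^-1)))%:E
    <= rho_star n (besov f0 s M) alpha gamma beta f0)%E.
Proof.
move=> z a0 s0 n2; have n0 : 0 < n%:R :> R by rewrite ltr0n; exact: ltnW n2.
have l2 := ln_ge_half n2; set l := ln n%:R in l2 *.
have z0 : 0 < z by rewrite subr_gt0 ltr_expR; lra.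
set B := n%:R * z ^+ 2; have B0 : 0 < B by rewrite mulr_gt0// exprn_gt0.
have d0 : 0 < 4 * s + 3 by lra.
have d1 : 0 < 4 * s + 1 by lra.
pose t := ln B / (4 * s + 3).
have pE : B `^ (- (2 * s) / (4 * s + 3)) = expR (- (2 * s * t)).
  by rewrite powR_expR//; congr expR; rewrite /t; field; rewrite gt_eqF.
rewrite pE powR_expR// ltr_expR -/l => tl.
have tl2 : t <= l.
  have h : t < l / (4 * s + 1).
    rewrite -(ltr_pM2l (_ : 0 < 2 * s)) ?mulr_gt0// -ltrN2.
    by move: tl; congr (_ < _); field; rewrite gt_eqF.
  by apply: (le_trans (ltW h)); rewrite ler_pdivrMr//; nra.
set r := Num.min _ _.
have r0 : 0 < r by rewrite lt_min expR_gt0 powR_gt0//; lra.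
have rt : r <= expR (- (2 * s * t)) by rewrite ge_min lexx.
have rl : r ^+ 2 * l <= 1.
  have : r ^+ 2 <= (l `^ (- 2^-1)) ^+ 2.
    by rewrite lerXn2r ?nnegrE ?powR_ge0 ?(ltW r0)// ge_min lexx orbT.
  have -> : (l `^ (- 2^-1)) ^+ 2 = l^-1.
    rewrite -powR_mulrn ?powR_ge0// -powRrM -[RHS]powR_inv1; last lra.
    by congr (_ `^ _); field.
  by move=> h; rewrite -ler_pdivlMr ?div1r; [exact: h|lra].
have r2 : r ^+ 2 <= 2 by have := sqr_ge0 r; nra.
have BE : B ^+ 2 = expR (2 * (4 * s + 3) * t).
  rewrite -[B]lnK ?posrE// -expRM_natl; congr expR; rewrite /t; field.
  by rewrite gt_eqF.
have g1 := gamma1.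
have nn : (0 < n)%N := ltnW n2.
have C2 := C1; have Cpos := C0; have Ceps := Ce; have CM2 := CM.
pose D := 2 * C * r ^+ 2.
have D0 : 0 < D by rewrite !mulr_gt0// exprn_gt0.
have [J [JM Jsmall Jn]] : exists J, [/\ D <= M ^+ 2 * 2 `^ (- (2 * J%:R * s)),
    (B * D) ^+ 2 <= 32 * C * (2 ^+ J) ^+ 3 & 2 ^+ J <= n%:R ^+ 2 :> R].
  have [t0|t0] := leP 0 t.
    have [J [/andP[J1 J2] Js]] := dyadic_resolution t0; exists J; split.
    - have h : r ^+ 2 <= 2 `^ (- (2 * J%:R * s)).
        apply: le_trans (Js s s0).
        have -> : - (4 * s * t) = 2 * (- (2 * s * t)) by ring.
        by rewrite expRM_natl lerXn2r ?nnegrE ?expR_ge0 ?(ltW r0).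
      by rewrite /D ler_pM// ?ltW ?mulr_gt0 ?exprn_gt0//; lra.
    - have BD : (B * D) ^+ 2 = 4 * C ^+ 2 *
          (expR (2 * t) ^+ 3 * (expR (2 * s * t) * r) ^+ 4).
        have -> : (B * D) ^+ 2 = 4 * C ^+ 2 * (B ^+ 2 * r ^+ 4) by rewrite /D; ring.
        have -> : B ^+ 2 = expR (2 * t) ^+ 3 * expR (2 * s * t) ^+ 4.
          by rewrite BE -!expRM_natl -expRD; congr expR; ring.
        by rewrite exprMn !mulrA.
      have x1 : expR (2 * s * t) * r <= 1.
        by move: rt; rewrite expRN -div1r ler_pdivlMr ?expR_gt0// mulrC.
      rewrite BD; apply: (@le_trans _ _ (4 * C ^+ 2 * ((2 * 2 ^+ J) ^+ 3 * 1))).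
        apply: ler_wpM2l; first by rewrite mulr_ge0 ?sqr_ge0.
        apply: ler_pM.
        + by rewrite exprn_ge0 ?expR_ge0.
        + by rewrite exprn_ge0// mulr_ge0 ?expR_ge0// ltW.
        + by rewrite lerXn2r ?nnegrE ?expR_ge0// mulr_ge0// exprn_ge0.
        + by rewrite exprn_ile1// mulr_ge0 ?expR_ge0// ltW.
      have -> : 4 * C ^+ 2 * ((2 * 2 ^+ J) ^+ 3 * 1) =
          32 * C * (C * (2 ^+ J) ^+ 3) by ring.
      rewrite ler_wpM2l ?mulr_ge0 ?(ltW C0)// ler_piMl ?exprn_ge0//; lra.
    - apply: (le_trans J1); rewrite -[n%:R]lnK ?posrE// -expRM_natl ler_expR -/l.
      by rewrite ler_pM2l.
  exists 0%N; split.
  - by rewrite mulr0 mul0r oppr0 powRr0 mulr1 /D; nra.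
  - have B1 : B ^+ 2 <= 1.
      by rewrite BE -[leRHS]expR0 ler_expR pmulr_rle0 ?(ltW t0)// mulr_gt0.
    have D2 : D <= 4 * C by rewrite /D; nra.
    have D2' : D ^+ 2 <= 16 * C ^+ 2.
      have -> : 16 * C ^+ 2 = (4 * C) ^+ 2 by ring.
      by rewrite lerXn2r ?nnegrE ?(ltW D0)// mulr_ge0// ltW.
    rewrite expr0 expr1n mulr1 exprMn.
    apply: (@le_trans _ _ (1 * (16 * C ^+ 2))); first by rewrite ler_pM ?sqr_ge0.
    by rewrite mul1r; nra.
  - by rewrite expr0 -natrX ler1n expn_gt0 nn.
apply: rho_star_ge => Q privQ Delta lev.
have small : (n%:R * z ^+ 2 * D) ^+ 2 / (32 * (2 ^+ J) ^+ 3) <= e.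
  rewrite ler_pdivrMr ?mulr_gt0 ?exprn_gt0// (le_trans Jsmall)//.
  by rewrite [leRHS]mulrA ler_wpM2r ?exprn_ge0//; lra.
have tail : 2 * 2 ^+ J * expR (- (8 * D)^-1) <= e.
  apply: le_trans (polynomial_tail n2 C0 Ce C1); apply: ler_pM => //.
  - by rewrite ler_pM2l.
  - rewrite ler_expR lerN2 -/l /D.
    rewrite ler_pdivrMr ?mulr_gt0// mulrC ler_pdivlMr ?mulr_gt0 ?exprn_gt0//.
    nra.
have [f [fB fn fb]] := low_energy_alternative a0 nn privQ g1 gb1 lev D0 JM small tail.
exists f; split => //; apply: le_trans fn; rewrite lee_fin.
have -> : Num.sqrt C * r = Num.sqrt (C * r ^+ 2).
  by rewrite sqrtrM ?(ltW C0)// sqrtr_sqr ger0_norm ?(ltW r0).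
by rewrite ler_wsqrtr// /D; lra.
Qed.

End rates.

Theorem theorem3p4 (R : realType) (gamma beta M : R) :
  0 < gamma < 1 -> 0 < beta < 1 -> 2 * gamma + beta < 1 -> 0 < M ->
  exists c : R, 0 < c /\
    forall (alpha s : R) (n : nat), 0 < alpha -> 0 < s -> (2 <= n)%N ->
      let z := expR (2 * alpha) - expR (- (2 * alpha)) in
      let f0 := uniform_density R in
      ((c * Num.max
          (Num.min ((n%:R * z ^+ 2) `^ (- (2 * s) / (4 * s + 3)))
                   (ln n%:R `^ (- 2^-1)))
          (n%:R `^ (- (2 * s) / (4 * s + 1))))%:E
       <= rho_star n (besov f0 s M) alpha gamma beta f0)%E.
Proof.
move=> gamma01 beta01 gb M0.
have gamma1 : gamma < 1 by case/andP: gamma01.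
have gb1 : gamma + beta < 1 by case/andP: gamma01 => *; lra.
exists (Num.sqrt (rate_const gamma beta M)); split.
  by rewrite sqrtr_gt0 rate_const_gt0.
move=> alpha s n alpha0 s0 n2; lazy zeta.
have nonpriv := nonprivate_rate gamma1 gb1 M0 alpha s0 n2.
rewrite maxEle; case: ifPn => // ; rewrite -ltNge lt_min => /andP[priv _].
exact: private_rate.
Qed.
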